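(* Let $n\ge 3$, let $k_1,\dots,k_n$ be nonnegative integers with $\sum_{i=1}^n k_i\le n-3$, and let $d = n-3-\sum_{i=1}^n k_i$. Put $k_i=0$ for $i=n+1,\dots,n+d-1$. Then the maximal cones in $\psi_1^{k_1}\cdot\dots\cdot\psi_n^{k_n}\cdot\mathcal{M}_n$ are in bijection to the ordered moduli sequences $P=(P_1,\dots,P_{n+d-1})\in\mathcal{P}_{n,d}^<$ that fulfill the following condition: for any $a\in\{n+1,\dots,n+d+1\}$, if $j_1,\dots,j_{l(a)}\in\{1,\dots,n+d-1\}$ are the indices $j$ such that $P_j=a$, then $$l(a) = 2+\sum_{l=1}^{l(a)}k_{j_l}.$$
   Context: An $n$-marked rational tropical curve is a metric tree with $n$ unbounded edges (leaves) labelled $1,\dots,n$, all of whose vertices are at least trivalent. For such a curve $C$ let $d(C)\in\mathbb{R}^{\binom n2}$ be the vector of distances $d(C)_{i,j}$ ($i<j$) between leaves. With $\Phi_n:\mathbb{R}^n\to\mathbb{R}^{\binom n2}$, $a\mapsto(a_i+a_j)_{i<j}$, let $\mathcal{M}_n := \{d(C) : C\ n\text{-marked curve}\}\subseteq\mathbb{R}^{\binom n2}/\Phi_n(\mathbb{R}^n)$. It is a fan whose cones (in the combinatorial subdivision) correspond to combinatorial types of curves (curves up to forgetting the metric), the dimension of a cone being the number of bounded edges. Psi-classes: the $i$-th Psi-class $\psi_i$ on $\mathcal{M}_n$ is the closure of the locus of curves with a unique four-valent vertex, to which leaf $i$ is attached (all other vertices being trivalent), with weight 1 on each cone. For nonnegative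 integers $k_1,\dots,k_n$ and $I\subseteq[n]=\{1,\dots,n\}$ put $K(I)=\sum_{i\in I}k_i$. By a theorem of Kerber and Markwig (which may be taken here as the description of the intersection product), $\psi_1^{k_1}\cdot\dots\cdot\psi_n^{k_n}\cdot\mathcal{M}_n$ is the subfan of $\mathcal{M}_n$ consisting of the closure of the cones of dimension $n-3-K([n])$ corresponding to the combinatorial types of curves $C$ such that each vertex $V$ of $C$ satisfies $\mathrm{val}(V)=K(I_V)+3$, where $I_V=\{i\in[n] : \text{leaf } i\text{ is adjacent to }V\}$; the weight of such a cone is $\prod_V K(I_V)!/\prod_i k_i!$. A moduli Prüfer sequence of order $n\ge3$ and length $d\ge0$ is a sequence $(a_1,\dots,a_{n+d-1})$ with $a_i\in\{n+1,\dots,n+d+1\}$ such that each element of $\{n+1,\dots,n+d+1\}$ occurs at least twice. It is ordered if, after removing all occurrences of each entry but the first, the remaining sequence is sorted ascendingly. $\mathcal{P}_{n,d}^<$ denotes the set of ordered moduli sequences of order $n$ and length $d$.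
   Formalization: The case d = 0 with k_n > 0 is excluded (for d = 0, k_n = 0 is assumed): there the product has exactly one maximal cone, but the only moduli sequence (n+1,…,n+1) has length n−1 and would need n−1 = n−1−k_n, so the claim as stated fails, e.g. n = 4, k = (0,0,0,1). *)

(* Defs.v *)
From HB Require Import structures.
From mathcomp Require Import all_boot all_order all_algebra.
From mathcomp Require Import all_classical all_reals all_analysis.
Import numFieldNormedType.Exports.

Set Implicit Arguments.
Unset Strict Implicit.
Unset Printing Implicit Defensive.

Import Order.TTheory GRing.Theory Num.Theory.

(* Leaves, indices of k and positions in a sequence are numbered from 0 in this
   file: the leaf labelled i in the usual 1-based numbering is the element of
   'I_n with value i - 1.  The entries of a moduli sequence keep their usual
   values n+1, ..., n+d+1. *)

(* The bounded part of a curve is a finite simple graph on [vertex]; the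
   unbounded edges are only recorded through the vertex they are attached to. *)
Record marked_graph (n : nat) := MarkedGraph {
  vertex : finType;
  adj : rel vertex;
  leaf_vertex : 'I_n -> vertex }.

Section CombinatorialTypes.
Variables (n : nat) (T : marked_graph n).

Definition bounded_edges : {set {set vertex T}} :=
  [set e : {set vertex T} |
    [exists v : vertex T, [exists w : vertex T, adj v w && (e == [set v; w])]]].

Definition leaves_at (v : vertex T) : {set 'I_n} :=
  [set i | leaf_vertex T i == v].

Definition valence (v : vertex T) : nat :=
  #|[set w | adj v w]| + #|leaves_at v|.

Definition simple_path (v w : vertex T) (p : seq (vertex T)) : Prop :=
  [/\ path (@adj n T) v p, last v p = w & uniq (v :: p)].

Definition is_tree : Prop :=
  [/\ symmetric (@adj n T), irreflexive (@adj n T)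
    & forall v w, exists! p, simple_path v w p].

Definition is_combinatorial_type : Prop :=
  is_tree /\ forall v : vertex T, 3 <= valence v.

End CombinatorialTypes.

Definition leaf_pair (n : nat) := {p : 'I_n * 'I_n | p.1 < p.2}.

Local Open Scope ring_scope.

Section TropicalModuli.
Variables (R : realType) (n : nat).

Definition dist_space := {ptws leaf_pair n -> R}.

Definition Phi (a : 'I_n -> R) : dist_space :=
  fun p => a (val p).1 + a (val p).2.

Definition phi_rel (x y : dist_space) : bool :=
  `[< exists a : 'I_n -> R, forall p, x p - y p = Phi a p >].

Lemma phi_rel_refl : reflexive phi_rel.
Proof. by move=> x; apply/asboolP; exists (fun=> 0) => p; rewrite /Phi addr0 subrr. Qed.

Lemma phi_rel_sym : symmetric phi_rel.
Proof.
suff H x y : phi_rel x y -> phi_rel y x by move=> x y; apply/idP/idP; exact: H.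
move=> /asboolP[a xy]; apply/asboolP; exists (fun i => - a i) => p.
by rewrite /Phi -opprD -[a _ + _]xy opprB.
Qed.

Lemma phi_rel_trans : transitive phi_rel.
Proof.
move=> y x z /asboolP[a xy] /asboolP[b yz]; apply/asboolP.
exists (fun i => a i + b i) => p.
by rewrite /Phi addrACA -[a _ + _]xy -[b _ + _]yz addrA subrK.
Qed.

Canonical phi_equiv := EquivRel phi_rel phi_rel_refl phi_rel_sym phi_rel_trans.

Definition dist_quot := quotient_topology {eq_quot phi_equiv}%qT.

Definition dist_class (x : dist_space) : dist_quot :=
  (\pi_({eq_quot phi_equiv}) x)%qT.

(* A curve of combinatorial type T is T with a positive length on each bounded
   edge. *)
Definition is_metric (T : marked_graph n) (len : {set vertex T} -> R) : Prop :=
  forall e, e \in bounded_edges T -> 0 < len e.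

Definition path_length (T : marked_graph n) (len : {set vertex T} -> R)
    (v : vertex T) (p : seq (vertex T)) : R :=
  \sum_(e <- pairmap (fun x y => [set x; y]%SET) v p) len e.

(* [xget] selects the simple path from v to w, which is unique in a tree. *)
Definition dist (T : marked_graph n) (len : {set vertex T} -> R)
    (v w : vertex T) : R :=
  path_length len v (xget [::] [set p | simple_path v w p]%classic).

(* Leaves have infinite length, so the distance between two of them is measured
   between the vertices to which they are attached; another normalization
   changes the vector only by an element of the image of Phi. *)
Definition dist_vector (T : marked_graph n) (len : {set vertex T} -> R)
    : dist_space :=
  fun p => dist len (leaf_vertex T (val p).1) (leaf_vertex T (val p).2).

Local Open Scope classical_set_scope.

Definition curves_of_type (T : marked_graph n) : set dist_quot :=
  [set dist_class (dist_vector len) | len in @is_metric T].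

Definition cone (T : marked_graph n) : set dist_quot :=
  closure (curves_of_type T).

Definition Mn_cones : set (set dist_quot) :=
  [set s | exists T : marked_graph n, is_combinatorial_type T /\ s = cone T].

(* The description of psi_1^k_1 ... psi_n^k_n . M_n due to Kerber and Markwig.
   The weights prod_V K(I_V)! / prod_i k_i! are positive and play no role for
   the set of cones. *)
Definition psi_top_cones (k : 'I_n -> nat) : set (set dist_quot) :=
  [set s | exists T : marked_graph n,
     [/\ is_combinatorial_type T,
         #|bounded_edges T| = (n - 3 - \sum_i k i)%N,
         forall v : vertex T,
           valence v = (\sum_(i in leaves_at v) k i + 3)%N
       & s = cone T]].

(* The closure of these cones: the faces of a cone of the fan M_n are the cones
   of M_n that it contains. *)
Definition psi_product (k : 'I_n -> nat) : set (set dist_quot) :=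
  [set s | Mn_cones s /\ exists2 t, psi_top_cones k t & s `<=` t].

Definition maximal_cones (F : set (set dist_quot)) : set (set dist_quot) :=
  [set s | F s /\ forall t, F t -> s `<=` t -> t = s].

End TropicalModuli.

Local Open Scope nat_scope.

Definition is_moduli_sequence (n d : nat) (P : (n + d).-1.-tuple nat) : Prop :=
  (forall a, a \in P -> n + 1 <= a <= n + d + 1) /\
  (forall a, n + 1 <= a <= n + d + 1 -> 2 <= count_mem a P).
Arguments is_moduli_sequence n d P : clear implicits.

(* [undup] keeps the last occurrence of each entry, hence the reversals. *)
Definition first_occurrences (s : seq nat) : seq nat := rev (undup (rev s)).

Definition is_ordered (s : seq nat) : Prop := sorted leq (first_occurrences s).

Definition ordered_moduli_sequences (n d : nat)
    : set ((n + d).-1.-tuple nat) :=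
  [set P | is_moduli_sequence n d P /\ is_ordered P]%classic.
Arguments ordered_moduli_sequences n d : clear implicits.

Definition extend0 (n : nat) (k : 'I_n -> nat) (j : nat) : nat :=
  if insub j is Some i then k i else 0.

(* Main.v *)
Require Import Defs.
From mathcomp Require Import all_boot all_order all_algebra.
From mathcomp Require Import all_classical all_reals all_analysis.
From mathcomp Require Import fintype finset.
From mathcomp Require Import ring lra.

Set Implicit Arguments.
Unset Strict Implicit.
Unset Printing Implicit Defensive.

Import Order.TTheory GRing.Theory Num.Theory.
Import numFieldNormedType.Exports.

(** Both sides of the bijection are finite, so it is enough to count them; the count
    goes through trees and sequences whose [d+1] inner vertices, respectively letters,
    carry arbitrary labels.

    Trees.  A tree is rooted at the vertex of its first leaf and encoded by its parent
    map.  The cluster of a vertex is the set of leaves below it.  As all vertices are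
    at least trivalent, inclusion of clusters is the ancestor relation
    ([cluster_subset]), so the tree can be read off from its clusters
    ([cluster_determines]).  Every edge separates the cluster of its lower end from
    the other leaves; hence the distance vectors of the curves of a type, and the cone,
    depend on the family of clusters alone ([curves_of_typeE]).  Conversely a cone
    determines the clusters: the four-point expression
    [x_ik + x_jl - x_ij - x_kl] is well defined modulo [Phi], continuous, positive if an
    edge separates [ij] from [kl], and nonpositive otherwise.  Thus an inclusion of
    cones gives an inclusion of quartets, and then of clusters ([displays_subset],
    [family_cone_subset]).  All top cones have [d+1] clusters, therefore they are the
    maximal cones, and they correspond to the cluster families of the trees in
    question ([maximal_psi_cones]).  A family is obtained from [(d+1)!] labelled trees,
    since different vertices have different clusters ([card_psi_trees]).

    Sequences.  By Pruefer's recursion, which removes a vertex without children, the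
    parent maps with root [r] and prescribed numbers of children are as many as the
    words with last letter [r] in which each vertex occurs as often as it has children
    ([card_parent_maps]).  Writing the word after the list of the vertices of the [n]
    leaves, each vertex occurs once less than its valence, except that the root occurs
    as often as its valence; the last letter repeats the first one, and without it one
    gets a sequence of length [n+d-1] in which each [a] occurs exactly
    [val(a) - 1 = 2 + K(I_a)] times
    ([card_psi_codes]).  The [(d+1)!] relabellings of such a sequence are distinct, and
    exactly one of them is ordered ([card_ordered_codes]).  So the factor [(d+1)!]
    cancels. *)

(** * Rooted trees given by a parent map *)

(** A rooted tree is encoded by its parent map, with the root as fixed point;
    [fconnect p v w] then says that [w] is an ancestor of [v] or [v] itself. *)
Definition rooted (V : finType) (r : V) (p : V -> V) : bool :=
  (p r == r) && [forall v, fconnect p v r].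

Definition children (V : finType) (p : V -> V) (v : V) : {set V} :=
  [set c | (c != v) && (p c == v)].

Section RootedTree.
Variables (V : finType) (r : V) (p : V -> V).
Hypothesis p_rooted : rooted r p.

Lemma parent_root : p r = r.
Proof. by case/andP: p_rooted => /eqP. Qed.

Lemma ancestor_root v : fconnect p v r.
Proof. by case/andP: p_rooted => _ /forallP. Qed.

Lemma iter_parent_root k : iter k p r = r.
Proof. by elim: k => //= k ->; exact: parent_root. Qed.

Lemma root_ancestor v : fconnect p r v -> v = r.
Proof. by move=> rv; rewrite -(iter_findex rv) iter_parent_root. Qed.

(** A vertex that comes back to itself after at least one step would never reach
    the root, unless it is the root. *)
Lemma iter_parent_loop k v : 0 < k -> iter k p v = v -> v = r.
Proof.
move=> k_gt0 vk; have vN j : iter (j * k) p v = v.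
  by elim: j => //= j IHj; rewrite mulSn iterD IHj.
have := iter_findex (ancestor_root v); set N := findex _ _ _ => vr.
have := vN N; rewrite -[N * k](@subnK N); last by rewrite leq_pmulr.
by rewrite iterD vr iter_parent_root.
Qed.

Lemma ancestor_antisym v w : fconnect p v w -> fconnect p w v -> v = w.
Proof.
move=> vw wv; move: (iter_findex vw) (iter_findex wv).
set a := findex _ _ _; set b := findex _ _ _ => va wb.
have [a0|a_gt0] := posnP a; first by rewrite -va a0.
have v_r : v = r.
  by apply: (@iter_parent_loop (b + a)); rewrite ?addn_gt0 ?a_gt0 ?orbT // iterD va.
by rewrite -va v_r iter_parent_root.
Qed.

Lemma ancestor_chain u v w :
  fconnect p u v -> fconnect p u w -> fconnect p v w || fconnect p w v.
Proof.
move=> uv uw; rewrite -(iter_findex uv) -(iter_findex uw).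
set a := findex _ _ _; set b := findex _ _ _.
case/orP: (leq_total a b) => [/subnK <-|/subnK <-]; rewrite iterD fconnect_iter ?orbT //.
Qed.

Lemma parentN_ancestor v : v != r -> ~~ fconnect p (p v) v.
Proof.
move=> v_r; apply: contra v_r => pvv; apply/eqP.
have := iter_findex pvv; rewrite -iterSr; exact: iter_parent_loop.
Qed.

Lemma parent_neq v : v != r -> p v != v.
Proof. by move=> /parentN_ancestor; apply: contra => /eqP ->. Qed.

Lemma ancestor_parent u v : fconnect p u v -> u != v -> fconnect p (p u) v.
Proof. by rewrite fconnect_eqVf => /orP[/eqP->|//]; rewrite eqxx. Qed.

Lemma child_neq_root c v : c \in children p v -> c != r.
Proof.
rewrite inE => /andP[cv /eqP pc]; apply: contra cv => /eqP c_r.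
by rewrite -pc c_r parent_root.
Qed.

Lemma children_ancestor c v : c \in children p v -> fconnect p c v.
Proof. by rewrite inE => /andP[_ /eqP <-]; exact: fconnect1. Qed.

Lemma childN_ancestor c v : c \in children p v -> ~~ fconnect p v c.
Proof.
move=> cv; have := parentN_ancestor (child_neq_root cv).
by move: cv; rewrite inE => /andP[_ /eqP ->].
Qed.

Lemma child_toward u v : fconnect p u v -> u != v ->
  exists2 c, c \in children p v & fconnect p u c.
Proof.
move=> uv; have := iter_findex uv; move: (findex p u v) => k.
elim: k u {uv} => [|k IHk] u /=.
  by move=> ->; rewrite eqxx.
rewrite -iterS iterSr => puv u_v.
have [puv'|pu_v] := eqVneq (p u) v.
  by exists u; rewrite ?connect0 // inE u_v puv' eqxx.
have [c cv puc] := IHk _ puv pu_v; exists c => //.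
exact: connect_trans (fconnect1 _ _) puc.
Qed.

Lemma children_disjoint u v c c' :
  c \in children p v -> c' \in children p v ->
  fconnect p u c -> fconnect p u c' -> c = c'.
Proof.
move=> cv c'v uc uc'; apply/eqP; apply: contraT => c_c'.
wlog cc' : c c' cv c'v c_c' uc uc' / fconnect p c c'.
  move=> H; case/orP: (ancestor_chain uc uc') => ?; first exact: (H c c').
  by apply: (H c' c); rewrite // eq_sym.
have := ancestor_parent cc' c_c'; move: (cv); rewrite inE => /andP[_ /eqP ->].
by rewrite (negPf (childN_ancestor c'v)).
Qed.


End RootedTree.

(** * Clusters of a rooted tree with marked leaves *)

Definition leaf_set (n : nat) (V : finType) (lam : 'I_n -> V) (v : V) : {set 'I_n} :=
  [set i | lam i == v].

Definition cluster (n : nat) (V : finType) (lam : 'I_n -> V) (p : V -> V) (v : V)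
  : {set 'I_n} := [set i | fconnect p (lam i) v].

Definition cluster_family (n : nat) (V : finType) (lam : 'I_n -> V) (p : V -> V)
  : {set {set 'I_n}} := [set cluster lam p v | v : V].

Definition rooted_valence (n : nat) (V : finType) (lam : 'I_n -> V) (r : V)
    (p : V -> V) (v : V) : nat :=
  #|children p v| + (v != r) + #|leaf_set lam v|.

Section Clusters.
Variables (n : nat) (V : finType) (lam : 'I_n -> V) (rho : 'I_n) (p : V -> V).
Hypothesis p_rooted : rooted (lam rho) p.
Local Notation r := (lam rho).
Hypothesis trivalent : forall v, 3 <= rooted_valence lam r p v.
Local Notation C := (cluster lam p).

Lemma cluster_root : C r = [set: 'I_n].
Proof. by apply/setP => i; rewrite !inE (ancestor_root p_rooted). Qed.

Lemma rho_cluster v : (rho \in C v) = (v == r).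
Proof.
rewrite inE; apply/idP/eqP => [|->]; last exact: connect0.
exact: (root_ancestor p_rooted).
Qed.

Lemma cluster_ancestor v w : fconnect p v w -> C v \subset C w.
Proof.
by move=> vw; apply/subsetP => i; rewrite !inE => iv; exact: connect_trans iv vw.
Qed.

(** By descent to a child as long as there is no leaf at the vertex. *)
Lemma cluster_neq0 v : exists i, i \in C v.
Proof.
have [k] := ubnP #|[set u | fconnect p u v]|; elim: k v => // k IHk v.
rewrite ltnS => lek; have [lv0|[i]] := set_0Vmem (leaf_set lam v); last first.
  by rewrite inE => /eqP iv; exists i; rewrite inE iv connect0.
have := trivalent v; rewrite /rooted_valence lv0 cards0 addn0.
have [ch0|[c cv]] := set_0Vmem (children p v); first by rewrite ch0 cards0; case: (v != r).
have [|i ic] := IHk c; last first.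
  by exists i; exact: (subsetP (cluster_ancestor (children_ancestor cv))) ic.
apply: leq_trans lek; apply: proper_card; apply/properP; split.
  apply/subsetP => u; rewrite !inE => uc.
  exact: connect_trans uc (children_ancestor cv).
by exists v; rewrite inE ?connect0 ?(negPf (childN_ancestor p_rooted cv)).
Qed.

(** This is where trivalence enters: besides the branch of a child [c] and the
    direction of the root leaf, a vertex has a third branch, and it carries a leaf. *)
Lemma other_branch v c : c \in children p v ->
  exists i, [/\ i \in C v, i \notin C c & i != rho].
Proof.
move=> cv; have [/eqP lv0|[i]] := set_0Vmem (leaf_set lam v :\ rho); last first.
  rewrite !inE => /andP[i_rho /eqP iv]; exists i; rewrite !inE iv connect0.
  by rewrite (negPf (childN_ancestor p_rooted cv)).
have {lv0} lv : #|leaf_set lam v| <= (v == r).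
  rewrite (cardsD1 rho) inE eq_sym; move: lv0; rewrite -cards_eq0 => /eqP ->.
  by rewrite addn0.
have [ch|[c']] := set_0Vmem (children p v :\ c).
  have := trivalent v; rewrite /rooted_valence (cardsD1 c) ch cards0 cv.
  move=> /leq_trans/(_ (leq_add (leqnn _) lv)).
  by case: (v == r).
rewrite in_setD1 => /andP[c'c c'v]; have [i ic'] := cluster_neq0 c'.
exists i; split.
- exact: (subsetP (cluster_ancestor (children_ancestor c'v))) ic'.
- apply: contra c'c; rewrite inE => ic; rewrite inE in ic'.
  by apply/eqP; exact: (children_disjoint p_rooted c'v cv ic' ic).
- apply: contraTneq ic' => ->; rewrite rho_cluster.
  exact: (child_neq_root p_rooted c'v).
Qed.

Lemma cluster_subset v w : (C v \subset C w) = fconnect p v w.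
Proof.
apply/idP/idP; last exact: cluster_ancestor.
move=> vw; have [i iv] := cluster_neq0 v; have iw := subsetP vw i iv.
rewrite inE in iv; rewrite inE in iw.
case/orP: (ancestor_chain iv iw) => // wv.
have [->|w_v] := eqVneq w v; first exact: connect0.
have [c cv wc] := child_toward wv w_v; have [j [jv jc _]] := other_branch cv.
by case/negP: jc; apply: (subsetP (cluster_ancestor wc)); exact: (subsetP vw).
Qed.

Lemma cluster_inj : injective C.
Proof.
move=> v w Cvw; apply: (ancestor_antisym p_rooted);
by rewrite -cluster_subset Cvw.
Qed.

Lemma card_cluster_family : #|cluster_family lam p| = #|V|.
Proof. by rewrite card_imset //; exact: cluster_inj. Qed.

Lemma cluster_laminar v w i : i \in C v -> i \in C w ->
  (C v \subset C w) || (C w \subset C v).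
Proof. by rewrite !cluster_subset !inE; exact: ancestor_chain. Qed.

Lemma cluster_two v : v != r -> exists i j, [/\ i \in C v, j \in C v & i != j].
Proof.
move=> v_r; have [ch0|[c cv]] := set_0Vmem (children p v); last first.
  have [i [iv ic _]] := other_branch cv; have [j jc] := cluster_neq0 c.
  exists i, j; split => //.
    exact: (subsetP (cluster_ancestor (children_ancestor cv))) jc.
  by apply: contraNneq ic => ->.
have := trivalent v; rewrite /rooted_valence ch0 cards0 v_r add0n add1n ltnS.
move=> /card_gt1P[i [j [iv jv ij]]]; exists i, j.
by move: iv jv; rewrite !inE => /eqP -> /eqP ->; rewrite connect0.
Qed.

Lemma cluster_coleaf v : v != r -> exists2 k, k \notin C v & k != rho.
Proof.
move=> v_r; have [|i [_ iv i_rho]] := @other_branch (p v) v.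
  by rewrite inE eqxx eq_sym (parent_neq p_rooted).
by exists i.
Qed.

End Clusters.

Lemma cluster_parent_sub n (V : finType) (lam lam' : 'I_n -> V) (rho : 'I_n)
    (p p' : V -> V) :
  rooted (lam rho) p -> (forall v, 3 <= rooted_valence lam (lam rho) p v) ->
  rooted (lam' rho) p' -> (forall v, 3 <= rooted_valence lam' (lam' rho) p' v) ->
  cluster lam p =1 cluster lam' p' ->
  [/\ fconnect p =2 fconnect p', forall i, fconnect p (lam i) (lam' i)
    & forall v, v != lam rho -> fconnect p (p v) (p' v)].
Proof.
move=> pr pt pr' pt' CC'.
have conn : fconnect p =2 fconnect p'.
  by move=> v w; rewrite -(cluster_subset pr pt) -(cluster_subset pr' pt') !CC'.
have lr i : fconnect p (lam i) (lam' i).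
  have : i \in cluster lam' p' (lam' i) by rewrite inE connect0.
  by rewrite -CC' inE.
split => // v v_r.
have rr : lam' rho = lam rho.
  by have /(root_ancestor pr) := lr rho.
apply: ancestor_parent; first by rewrite conn fconnect1.
by rewrite eq_sym (parent_neq pr') // rr.
Qed.

(** The tree can be read off from its clusters: inclusion of clusters is the
    ancestor relation, the parent is the least proper ancestor, and a leaf sits at
    the least vertex whose cluster contains it. *)
Lemma cluster_determines n (V : finType) (lam lam' : 'I_n -> V) (rho : 'I_n)
    (p p' : V -> V) :
  rooted (lam rho) p -> (forall v, 3 <= rooted_valence lam (lam rho) p v) ->
  rooted (lam' rho) p' -> (forall v, 3 <= rooted_valence lam' (lam' rho) p' v) ->
  cluster lam p =1 cluster lam' p' -> lam =1 lam' /\ p =1 p'.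
Proof.
move=> pr pt pr' pt' CC'.
have [conn lr par] := cluster_parent_sub pr pt pr' pt' CC'.
have [_ lr' par'] := cluster_parent_sub pr' pt' pr pt (fsym CC').
have ll : lam =1 lam'.
  by move=> i; apply: (ancestor_antisym pr) => //; rewrite conn.
split => // v; have [->|v_r] := eqVneq v (lam rho).
  by rewrite (parent_root pr) ll (parent_root pr').
apply: (ancestor_antisym pr); first exact: par.
by rewrite conn par' // -ll.
Qed.

Section Relabel.
Variables (n : nat) (V W : finType) (lam : 'I_n -> V) (p : V -> V).
Variables (phi : V -> W) (psi : W -> V).
Hypotheses (phiK : cancel phi psi) (psiK : cancel psi phi).
Local Notation p' := (phi \o p \o psi).
Local Notation lam' := (phi \o lam).

Lemma relabel_connect v w : fconnect p' (phi v) (phi w) = fconnect p v w.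
Proof.
have it k u : iter k p' (phi u) = phi (iter k p u).
  by elim: k => //= k ->; rewrite /= phiK.
apply/idP/idP => vw.
  have := iter_findex vw; rewrite it => /(can_inj phiK) <-; exact: fconnect_iter.
by rewrite -(iter_findex vw) -it fconnect_iter.
Qed.

Lemma relabel_rooted r : rooted r p -> rooted (phi r) p'.
Proof.
move=> pr; rewrite /rooted /= phiK (parent_root pr) eqxx /=.
by apply/forallP => w; rewrite -[w]psiK relabel_connect (ancestor_root pr).
Qed.

Lemma relabel_cluster v : cluster lam' p' (phi v) = cluster lam p v.
Proof. by apply/setP => i; rewrite !inE /= relabel_connect. Qed.

Lemma relabel_cluster_family : cluster_family lam' p' = cluster_family lam p.
Proof.
apply/setP => A; apply/imsetP/imsetP => [[w _ ->]|[v _ ->]].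
  by exists (psi w) => //; rewrite -relabel_cluster psiK.
by exists (phi v) => //; rewrite relabel_cluster.
Qed.

Lemma relabel_leaf_set v : leaf_set lam' (phi v) = leaf_set lam v.
Proof. by apply/setP => i; rewrite !inE /= (can_eq phiK). Qed.

Lemma relabel_valence r v :
  rooted_valence lam' (phi r) p' (phi v) = rooted_valence lam r p v.
Proof.
rewrite /rooted_valence relabel_leaf_set (can_eq phiK); congr (_ + _ + _).
rewrite -(card_imset _ (can_inj phiK)); apply: eq_card => w; rewrite inE.
rewrite -[w]psiK (mem_imset _ _ (can_inj phiK)) inE /= phiK.
by rewrite !(can_eq phiK).
Qed.

End Relabel.

(** * Marked graphs with a parent map *)

Section TreeGraph.
Variables (n : nat) (T : marked_graph n).
Local Notation V := (vertex T).
Local Notation adj := (@adj n T).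
Local Notation simple_path := (@simple_path n T).
Variables (r : V) (p : V -> V).
Hypothesis p_rooted : rooted r p.
Hypothesis adjE : forall v w : V, adj v w = (v != w) && ((p v == w) || (p w == v)).

Lemma tree_adj_sym : symmetric adj.
Proof. by move=> v w; rewrite !adjE eq_sym orbC. Qed.

Lemma tree_adj_parent v : v != r -> adj v (p v).
Proof. by move=> v_r; rewrite adjE eqxx eq_sym (parent_neq p_rooted). Qed.

(** The branch above [v] can only be entered through [v] ... *)
Lemma walk_outside v y q : path adj y q -> v \notin y :: q ->
  ~~ fconnect p y v -> ~~ fconnect p (last y q) v.
Proof.
elim: q y => //= z q IHq y /andP[yz zq]; rewrite inE negb_or => /andP[vy vzq] yv.
apply: IHq => //; apply: contra yv => zv; move: yz; rewrite adjE => /andP[_ /orP[]/eqP e].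
  by apply: connect_trans zv; rewrite -e fconnect1.
rewrite -e; apply: ancestor_parent zv _.
by apply: contraNneq vzq => ->; rewrite inE eqxx.
Qed.

(** ... and only be left through the parent of [v]. *)
Lemma walk_inside v y q : path adj y q -> p v \notin y :: q ->
  fconnect p y v -> fconnect p (last y q) v.
Proof.
elim: q y => //= z q IHq y /andP[yz zq]; rewrite inE negb_or => /andP[vy vzq] yv.
apply: IHq => //; move: yz; rewrite adjE => /andP[_ /orP[]/eqP e].
  rewrite -e; apply: ancestor_parent => //.
  by apply: contraNneq vzq => <-; rewrite e inE eqxx.
by apply: connect_trans yv; rewrite -e fconnect1.
Qed.

Variant first_step_spec (a b b' : V) : Prop :=
  | StepUp of a != r & b' = p a & ~~ fconnect p b a
  | StepDown of b' \in children p a & fconnect p b b'.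

(** A simple path goes up until its end is below it, then down. *)
Lemma first_step a b b' q : simple_path a b (b' :: q) -> first_step_spec a b b'.
Proof.
case=> /= /andP[ab' b'q] <- /andP[a_q _]; move: (ab'); rewrite adjE.
case/andP=> aNb' /orP[/eqP pa|/eqP pb'].
  have a_r : a != r by apply: contraNneq aNb' => a_r; rewrite -pa a_r (parent_root p_rooted).
  by left => //; apply: walk_outside => //; rewrite -pa (parentN_ancestor p_rooted).
right; first by rewrite inE eq_sym aNb' pb' eqxx.
by apply: walk_inside; rewrite ?pb' ?connect0.
Qed.

Lemma simple_path_behead a b b' q :
  simple_path a b (b' :: q) -> simple_path b' b q.
Proof. by case=> /= /andP[_ ?] ? /andP[_ ?]. Qed.

Lemma simple_path_unique a b q q' :
  simple_path a b q -> simple_path a b q' -> q = q'.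
Proof.
elim: q a q' => [|x q IHq] a [|y q'] // aq aq'.
- by case: aq aq' => _ /= <- _ [_ /= /esym e]; rewrite e mem_last.
- by case: aq' aq => _ /= <- _ [_ /= /esym e]; rewrite e mem_last.
suff exy : x = y.
  by subst y; rewrite (IHq _ _ (simple_path_behead aq) (simple_path_behead aq')).
case: (first_step aq) => [_ -> bNa|xa bx]; case: (first_step aq') => [_ -> bNa'|ya by_].
- by [].
- by case/negP: bNa; exact: connect_trans by_ (children_ancestor ya).
- by case/negP: bNa'; exact: connect_trans bx (children_ancestor xa).
- exact: (children_disjoint p_rooted xa ya bx by_).
Qed.

Lemma simple_path_exists a b : exists q, simple_path a b q.
Proof.
have to_root v : connect adj v r.
  apply: connect_sub (ancestor_root p_rooted v) => x y /= /eqP <-.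
  have [->|x_r] := eqVneq x r; first by rewrite (parent_root p_rooted) connect0.
  by apply: connect1; exact: tree_adj_parent.
have : connect adj a b.
  apply: connect_trans (to_root a) _.
  by rewrite (sym_connect_sym tree_adj_sym).
case/connectP => q /shortenP[q' aq' uq' _] ->; by exists q'.
Qed.

Lemma parent_is_tree : is_tree T.
Proof.
split; first exact: tree_adj_sym.
  by move=> v; rewrite adjE eqxx.
move=> v w; have [q vq] := simple_path_exists v w; exists q; split => // q' vq'.
exact: (simple_path_unique vq vq').
Qed.

Lemma parent_valence v : valence v = rooted_valence (leaf_vertex T) r p v.
Proof.
rewrite /valence /rooted_valence; congr (_ + _).
have -> : [set w | adj v w] = children p v :|: (if v != r then [set p v] else set0).
  apply/setP => w; rewrite !inE adjE eq_sym andb_orr orbC; congr (_ || _).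
  case: (eqVneq v r) => [->|v_r].
    by rewrite (parent_root p_rooted) inE eq_sym andNb.
  rewrite inE eq_sym [w == p v]eq_sym.
  by apply: andb_idl => /eqP <-; rewrite eq_sym (parent_neq p_rooted).
rewrite cardsU; case: (eqVneq v r) => [_|v_r]; first by rewrite setI0 cards0 addn0 subn0.
rewrite cards1 (_ : _ :&: _ = set0) ?cards0 ?subn0 //.
apply/setP => w; rewrite !inE andbC; apply/negP => /and3P[/eqP -> _ /eqP e].
have := parentN_ancestor p_rooted v_r.
by rewrite -{2}e fconnect1.
Qed.

Lemma parent_edge_inj : {in [pred v | v != r] &, injective (fun v => [set v; p v])}.
Proof.
move=> v w; rewrite !inE => v_r w_r e; apply/eqP; apply: contraT => vw.
have : v \in [set w; p w] by rewrite -e !inE eqxx.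
rewrite !inE (negPf vw) /= => /eqP v_pw.
have : w \in [set v; p v] by rewrite e !inE eqxx.
rewrite !inE eq_sym (negPf vw) /= => /eqP w_pv.
by have := parentN_ancestor p_rooted v_r; rewrite -w_pv v_pw fconnect1.
Qed.

Lemma bounded_edgesE : bounded_edges T = [set [set v; p v] | v : V & v != r].
Proof.
apply/setP => e; rewrite inE; apply/existsP/imsetP => [[v /existsP[w]]|[v v_r ->]].
  rewrite adjE => /andP[/andP[vw /orP[]/eqP e1] /eqP ->].
    exists v; rewrite ?inE ?e1 //.
    by apply: contraNneq vw => v_r; rewrite -e1 v_r (parent_root p_rooted).
  exists w; rewrite ?inE ?e1 1?setUC //.
  by apply: contraNneq vw => w_r; rewrite -e1 w_r (parent_root p_rooted).
exists v; apply/existsP; exists (p v); rewrite eqxx andbT tree_adj_parent //.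
by move: v_r; rewrite inE.
Qed.

Lemma card_bounded_edges : #|bounded_edges T|.+1 = #|V|.
Proof.
rewrite bounded_edgesE card_in_imset.
  by rewrite [RHS](cardD1 r) inE add1n; congr _.+1; apply: eq_card => v; rewrite !inE andbT.
by move=> v w; rewrite !inE; exact: parent_edge_inj.
Qed.

Section Distance.
Local Open Scope ring_scope.
Variables (R : realType) (len : {set V} -> R).

(** The edge above [v] is on the path exactly when one end point is below [v] and the
    other is not; the induction peels off the first edge, which changes this
    condition for that edge alone. *)
Lemma path_lengthE a b q : simple_path a b q ->
  path_length len a q =
    \sum_(v | v != r) len [set v; p v] *+ (fconnect p a v != fconnect p b v).
Proof.
elim: q a => [|b' q IHq] a ab.
  case: ab => _ /= <- _; rewrite /path_length /= big_nil big1 // => v _.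
  by rewrite eqxx mulr0n.
have up x v : v != x -> fconnect p x v = fconnect p (p x) v.
  by rewrite [LHS]fconnect_eqVf eq_sym => /negPf ->.
rewrite /path_length /= big_cons -/(path_length len b' q) (IHq _ (simple_path_behead ab)).
case: (first_step ab) => [a_r -> bNa|b'a bb'].
  rewrite (bigD1 a a_r) [in RHS](bigD1 a a_r) /= (negPf bNa) connect0.
  rewrite (negPf (parentN_ancestor p_rooted a_r)) eqxx mulr0n mulr1n add0r.
  by congr (_ + _); apply: eq_bigr => v /andP[_ va]; rewrite (up a).
have b'_r := child_neq_root p_rooted b'a.
rewrite (bigD1 b' b'_r) [in RHS](bigD1 b' b'_r) /= bb' connect0.
rewrite (negPf (childN_ancestor p_rooted b'a)) eqxx mulr0n mulr1n add0r.
move: b'a; rewrite inE => /andP[_ /eqP pb']; rewrite pb' setUC.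
by congr (_ + _); apply: eq_bigr => v /andP[_ vb']; rewrite (up b') // pb'.
Qed.

Lemma distE a b : dist len a b =
  \sum_(v | v != r) len [set v; p v] *+ (fconnect p a v != fconnect p b v).
Proof.
rewrite /dist; case: xgetP => [q _ /path_lengthE //|none].
by have [q abq] := simple_path_exists a b; case: (none q).
Qed.

End Distance.

End TreeGraph.

(** * The curves of a type in terms of its clusters *)

Section Families.
Local Open Scope ring_scope.
Variables (R : realType) (n : nat).

Definition split_vector (F : {set {set 'I_n}}) (l : {set 'I_n} -> R) : dist_space R n :=
  fun ij => \sum_(A in F) l A *+ (((val ij).1 \in A) != ((val ij).2 \in A)).

Definition family_curves (F : {set {set 'I_n}}) : set (dist_quot R n) :=
  [set dist_class (split_vector F l) | l in
    [set l : {set 'I_n} -> R | forall A, A \in F -> 0 < l A]]%classic.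

Definition family_cone (F : {set {set 'I_n}}) : set (dist_quot R n) :=
  closure (family_curves F).

Variables (T : marked_graph n) (rho : 'I_n) (p : vertex T -> vertex T).
Local Notation lam := (leaf_vertex T).
Local Notation r := (lam rho).
Hypothesis p_rooted : rooted r p.
Hypothesis adjE : forall v w : vertex T,
  adj v w = (v != w) && ((p v == w) || (p w == v)).
Hypothesis trivalent : forall v, (3 <= rooted_valence lam r p v)%N.
Local Notation C := (cluster lam p).
Local Notation F := (cluster_family lam p).

(** The cluster of the root contains all leaves and separates none. *)
Lemma split_vector_clusters (l : {set 'I_n} -> R) ij :
  split_vector F l ij =
    \sum_(v | v != r) l (C v) *+ (((val ij).1 \in C v) != ((val ij).2 \in C v)).
Proof.
rewrite /split_vector big_imset /=; last first.
  by move=> v w _ _; exact: (cluster_inj p_rooted trivalent).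
rewrite (bigID (fun v => v != r)) /= [X in _ + X]big1 ?addr0 // => v.
by rewrite negbK => /eqP ->; rewrite (cluster_root p_rooted) !inE mulr0n.
Qed.

Lemma dist_vector_clusters (len : {set vertex T} -> R) ij :
  dist_vector len ij =
    \sum_(v | v != r) len [set v; p v] *+ (((val ij).1 \in C v) != ((val ij).2 \in C v)).
Proof.
by rewrite /dist_vector (distE p_rooted adjE); apply: eq_bigr => v _; rewrite !inE.
Qed.

Lemma curves_of_typeE : curves_of_type (R := R) T = family_curves F.
Proof.
apply/seteqP; split => _ [l lP <-].
  pose l' A := if [pick v | (v != r) && (C v == A)] is Some v then l [set v; p v] else 1.
  exists l'.
    move=> A _; rewrite /l'; case: pickP => [v /andP[v_r _]|_]; last exact: ltr01.
    by apply: lP; rewrite (bounded_edgesE p_rooted adjE); apply/imsetP; exists v; rewrite ?inE.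
  congr dist_class; apply/funext => ij.
  rewrite split_vector_clusters dist_vector_clusters; apply: eq_bigr => v v_r.
  rewrite /l'; case: pickP => [w /andP[_ /eqP wv]|/(_ v)]; last by rewrite v_r eqxx.
  by rewrite (cluster_inj p_rooted trivalent wv).
pose l' e := if [pick v | (v != r) && ([set v; p v] == e)] is Some v then l (C v) else 1.
exists l'.
  move=> e _; rewrite /l'; case: pickP => [v _|_]; last exact: ltr01.
  by apply: lP; rewrite imset_f.
congr dist_class; apply/funext => ij.
rewrite split_vector_clusters dist_vector_clusters; apply: eq_bigr => v v_r.
rewrite /l'; case: pickP => [w /andP[w_r /eqP wv]|/(_ v)]; last by rewrite v_r eqxx.
by rewrite (parent_edge_inj p_rooted w_r v_r wv).
Qed.

Lemma coneE : cone (R := R) T = family_cone F.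
Proof. by rewrite /cone curves_of_typeE. Qed.

End Families.

(** Conversely every tree has a parent map towards any vertex [r]: the parent is
    the next vertex on the simple path to [r]. *)
Lemma tree_parent_map n (T : marked_graph n) (r : vertex T) : is_tree T ->
  exists p : vertex T -> vertex T, rooted r p /\
    forall v w : vertex T, adj v w = (v != w) && ((p v == w) || (p w == v)).
Proof.
case=> adj_sym adj_irr uniq_path; pose to_r v q := simple_path (T := T) v r q.
have /choice[path_to to_rP] v : exists q, to_r v q.
  by have [q [vq _]] := uniq_path v r; exists q.
have path_toE v q : to_r v q -> path_to v = q.
  have [q0 [_ q0E]] := uniq_path v r => vq.
  by rewrite -(q0E _ vq) -(q0E _ (to_rP v)).
pose p v := head v (path_to v).
have pE v w q : to_r v (w :: q) -> p v = w by move=> /path_toE vwq; rewrite /p vwq.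
have path_r : path_to r = [::] by apply: path_toE; split.
exists p; split.
  rewrite /rooted /p path_r eqxx /=; apply/forallP => v.
  have := to_rP v; elim: (path_to v) {1 3}v => [|w q IHq] u uq.
    by case: uq => _ /= -> _; exact: connect0.
  apply: (connect_trans (fconnect1 p u)); rewrite (pE _ _ _ uq); apply: IHq.
  exact: simple_path_behead uq.
move=> v w; apply/idP/andP => [vw|[vw /orP[]]].
- have vNw : v != w by apply: contraTneq vw => ->; rewrite adj_irr.
  split=> //; have [wq w_last w_uniq] := to_rP w.
  have [v_w|v_w] := boolP (v \in path_to w); last first.
    apply/orP; left; rewrite (pE v w (path_to w)) //.
    by split => //; [rewrite /= vw|rewrite cons_uniq w_uniq inE negb_or vNw v_w].
  apply/orP; right; case/splitPr def: _ / v_w => [q1 q2].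
  have vq2 : to_r v q2.
    move: wq w_last w_uniq; rewrite def cat_path /= last_cat => /and3P[_ _ ?] /= ?.
    by rewrite mem_cat cat_uniq => /and4P[_ _ _ ?]; split.
  suff w_vq2 : to_r w (v :: q2) by rewrite (pE _ _ _ w_vq2).
  case: (vq2) => ? ? uv; split => //=; first by rewrite adj_sym vw.
  move: w_uniq uv; rewrite def /= mem_cat negb_or => /andP[/andP[_ ->]] _.
  by rewrite andTb.
- rewrite /p; have := to_rP v; case: (path_to v) => [|x q] /= [vq _ _] /eqP xw.
    by rewrite xw eqxx in vw.
  by move: vq; rewrite /= xw => /andP[].
- rewrite /p; have := to_rP w; case: (path_to w) => [|x q] /= [wq _ _] /eqP xv.
    by rewrite xv eqxx in vw.
  by move: wq; rewrite /= xv adj_sym => /andP[].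
Qed.

(** * Cones and hierarchies *)

(** What the comparison of two cones needs to know about the clusters of a trivalent
    rooted tree; the last two fields make every proper cluster part of a quartet. *)
Record hierarchy (n : nat) (rho : 'I_n) (F : {set {set 'I_n}}) : Prop := Hierarchy {
  hierarchy_top : [set: 'I_n] \in F;
  hierarchy_rho : forall A, A \in F -> rho \in A -> A = [set: 'I_n];
  hierarchy_laminar : forall A B i, A \in F -> B \in F -> i \in A -> i \in B ->
    (A \subset B) || (B \subset A);
  hierarchy_two : forall A, A \in F -> A != [set: 'I_n] ->
    exists i j, [/\ i \in A, j \in A & i != j];
  hierarchy_coleaf : forall A, A \in F -> A != [set: 'I_n] ->
    exists2 k, k \notin A & k != rho }.

Lemma cluster_family_hierarchy n (V : finType) (lam : 'I_n -> V) (rho : 'I_n) (p : V -> V) :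
  rooted (lam rho) p -> (forall v, 3 <= rooted_valence lam (lam rho) p v) ->
  hierarchy rho (cluster_family lam p).
Proof.
move=> pr pt; have top := cluster_root pr.
have ntop v : cluster lam p v != [set: 'I_n] -> v != lam rho.
  by apply: contraNneq => ->; rewrite top.
split=> [|_ /imsetP[v _ ->]|_ _ i /imsetP[v _ ->] /imsetP[w _ ->]
        |_ /imsetP[v _ ->] /ntop|_ /imsetP[v _ ->] /ntop].
- by rewrite -top imset_f.
- by rewrite (rho_cluster pr) => /eqP ->; rewrite top.
- exact: (cluster_laminar pr pt).
- exact: (cluster_two pr pt).
- exact: (cluster_coleaf pr pt).
Qed.

Definition displays (n : nat) (F : {set {set 'I_n}}) (rho i j k : 'I_n) : Prop :=
  exists A, [/\ A \in F, i \in A, j \in A, k \notin A & rho \notin A].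

(** A hierarchy is determined by its rooted triples: if [A] is a cluster of [F], let
    [B] be the least cluster of [F'] containing [A] and let [k] be in [B] but not in
    [A]; the largest cluster of [F'] with a given [i] of [A] but without [k] contains
    [A], by the triples [ij|k], and is smaller than [B]. *)
Lemma displays_subset n (rho : 'I_n) (F F' : {set {set 'I_n}}) :
  hierarchy rho F -> hierarchy rho F' ->
  (forall i j k, i != j -> i != k -> j != k -> i != rho -> j != rho -> k != rho ->
     displays F rho i j k -> displays F' rho i j k) ->
  F \subset F'.
Proof.
move=> HF HF' FF'; apply/subsetP => A AF.
have [->|AT] := eqVneq A [set: 'I_n]; first exact: hierarchy_top HF'.
have rhoA : rho \notin A by apply: contra AT => /(hierarchy_rho HF AF) ->.
pose inF' B := (B \in F') && (A \subset B).
have inF'T : inF' [set: 'I_n] by rewrite /inF' (hierarchy_top HF') subsetT.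
case: (arg_minnP (fun B : {set 'I_n} => #|B|) inF'T) => B /andP[BF' AB] Bmin.
suff -> : A = B by [].
apply/eqP; apply: contraT => AneqB.
have [k [kB kA k_rho]] : exists k, [/\ k \in B, k \notin A & k != rho].
  have [BT|BT] := eqVneq B [set: 'I_n].
    by have [k kA k_rho] := hierarchy_coleaf HF AF AT; exists k; rewrite BT inE.
  have /properP[_ [k kB kA]] : A \proper B by rewrite properEneq AneqB.
  exists k; split => //; apply: contra BT => /eqP k_rho.
  by rewrite (hierarchy_rho HF' BF') // -k_rho.
have [i [j0 [iA j0A ij0]]] := hierarchy_two HF AF AT.
have notin x y : x \in A -> y \notin A -> x != y.
  by move=> xA; apply: contraNneq => <-.
have triple j : j \in A -> i != j -> displays F' rho i j k.
  move=> jA ij; apply: (FF' _ _ _ ij (notin _ _ iA kA) (notin _ _ jA kA)) => //.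
  - exact: notin.
  - exact: notin.
  - by exists A.
pose U0 D := [&& D \in F', i \in D & k \notin D].
have [D0 [D0F' iD0 _ kD0 _]] := triple j0 j0A ij0.
have UD0 : U0 D0 by rewrite /U0 D0F' iD0 kD0.
case: (arg_maxnP (fun D : {set 'I_n} => #|D|) UD0) => U /and3P[UF' iU kU] Umax.
have AU : A \subset U.
  apply/subsetP => j jA; have [<-//|ij] := eqVneq i j.
  have [D [DF' iD jD kD _]] := triple j jA ij.
  case/orP: (hierarchy_laminar HF' DF' UF' iD iU) => [/subsetP|UD]; first exact.
  have /eqP -> // : U == D.
  by rewrite eqEcard UD; apply: Umax; rewrite /U0 DF' iD kD.
have iB := subsetP AB i iA.
case/orP: (hierarchy_laminar HF' UF' BF' iU iB) => [UB|/subsetP/(_ k kB)]; last first.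
  by rewrite (negPf kU).
have : #|U| < #|B|.
  by apply: proper_card; apply/properP; split => //; exists k.
by rewrite ltnNge Bmin // /inF' UF' AU.
Qed.

Section ConeComparison.
Local Open Scope ring_scope.
Variables (R : realType) (n : nat).
Implicit Types (i j k : 'I_n) (F : {set {set 'I_n}}) (x y : dist_space R n).

(** [leaf_pair] only has increasing pairs, whereas the leaves of a quartet come in any
    order. *)
Definition coord x i j : R :=
  if insub (i, j) is Some q then x q
  else if insub (j, i) is Some q then x q else 0.

(** Twice the length of the path separating [ij] from [kl], when there is one; it is
    well defined modulo [Phi], and its sign detects the quartets of a tree. *)
Definition quartet x i j k l : R :=
  coord x i k + coord x j l - (coord x i j + coord x k l).

Lemma coord_split F (a : {set 'I_n} -> R) i j :
  coord (split_vector F a) i j = \sum_(A in F) a A *+ ((i \in A) != (j \in A)).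
Proof.
rewrite /coord /split_vector; case: insubP => [q _ /= ->//|ij].
case: insubP => [q _ /= ->|ji] /=; first by apply: eq_bigr => A _; rewrite eq_sym.
suff -> : i = j by rewrite big1 // => A _; rewrite eqxx mulr0n.
rewrite /= in ij ji.
by apply/ord_inj/eqP; rewrite eqn_leq (leqNgt i) (leqNgt j) ij ji.
Qed.

Lemma quartet_split F (a : {set 'I_n} -> R) i j k l :
  quartet (split_vector F a) i j k l =
  \sum_(A in F) (a A *+ ((i \in A) != (k \in A)) + a A *+ ((j \in A) != (l \in A))
    - (a A *+ ((i \in A) != (j \in A)) + a A *+ ((k \in A) != (l \in A)))).
Proof. by rewrite /quartet !coord_split -!big_split -sumrB. Qed.

Lemma coord_phi (a : 'I_n -> R) x y i j : (forall q, x q - y q = Phi a q) ->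
  i != j -> coord x i j - coord y i j = a i + a j.
Proof.
move=> xy ij; rewrite /coord; case: insubP => [q _ qij|nij].
  by rewrite xy /Phi qij.
case: insubP => [q _ qji|nji]; first by rewrite xy /Phi qji addrC.
rewrite /= in nij nji; move: ij; rewrite -(inj_eq (@ord_inj n)) neq_ltn.
by rewrite (negPf nij) (negPf nji).
Qed.

Lemma quartet_phi x y i j k l : dist_class x = dist_class y ->
  i != j -> i != k -> j != l -> k != l -> quartet x i j k l = quartet y i j k l.
Proof.
move=> /eqmodP /asboolP[a xy] ij ik jl kl.
apply/eqP; rewrite -subr_eq0 /quartet.
have e u v : u != v -> coord x u v = coord y u v + (a u + a v).
  by move=> uv; rewrite -(coord_phi xy uv) addrC subrK.
by rewrite !e //; apply/eqP; ring.
Qed.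

Lemma quartet_continuous i j k l : continuous (fun x => quartet x i j k l).
Proof.
have c u v : continuous (fun x => coord x u v).
  rewrite /coord; case: insubP => [q _ _|_]; first exact: proj_continuous.
  case: insubP => [q _ _|_]; first exact: proj_continuous.
  exact: (@cst_continuous _ _ (0 : R)).
move=> x; exact: (cvgB (cvgD (c i k x) (c j l x)) (cvgD (c i j x) (c k l x))).
Qed.

(** Quartet expressions are constant on the classes modulo [Phi] and continuous, so
    the locus where one of them is positive is open in the quotient. *)
Lemma quartet_closure (S : set (dist_quot R n)) i j k l x :
  i != j -> i != k -> j != l -> k != l ->
  (forall y, S (dist_class y) -> quartet y i j k l <= 0) ->
  closure S (dist_class x) -> quartet x i j k l <= 0.
Proof.
move=> ij ik jl kl S0 Sx; rewrite leNgt; apply/negP => q_gt0.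
pose U : set (dist_quot R n) := [set z | 0 < quartet (repr z) i j k l]%classic.
have UE y : U (dist_class y) = (0 < quartet y i j k l) :> Prop.
  rewrite /U /=; congr (is_true (0 < _)); apply: quartet_phi => //.
  exact: reprK.
have [|z [Sz Uz]] := Sx U.
  apply: open_nbhs_nbhs; split; last by rewrite UE.
  rewrite /open /= /quotient_open.
  rewrite (_ : _ @^-1` _ = (fun y => quartet y i j k l) @^-1` [set t | 0 < t])%classic.
    apply: open_comp; last exact: open_gt.
    by move=> y _; exact: quartet_continuous.
  by apply/seteqP; split => y; rewrite /preimage /= -UE.
have := S0 (repr z); rewrite /dist_class reprK => /(_ Sz).
by rewrite leNgt Uz.
Qed.

Lemma family_cone_subset (rho : 'I_n) F F' : hierarchy rho F -> hierarchy rho F' ->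
  (family_cone (R := R) F `<=` family_cone F')%classic -> F \subset F'.
Proof.
move=> HF HF' FF'; apply: (displays_subset HF HF') => i j k ij ik jk i_r j_r k_r FA.
apply: contrapT => F'N.
have topN A B : hierarchy rho B -> A \in B -> i \notin A -> rho \notin A.
  by move=> HB AB; apply: contra => /(hierarchy_rho HB AB) ->; rewrite inE.
have : quartet (split_vector F (fun=> 1 : R)) i j k rho <= 0.
  apply: quartet_closure (ij) (ik) (j_r) (k_r) _ _; last first.
    by apply/FF'/subset_closure; exists (fun=> 1) => // A _; exact: ltr01.
  move=> y [l l_gt0 /quartet_phi <- //]; rewrite quartet_split sumr_le0 // => A AF'.
  have lA := ltW (l_gt0 A AF').
  have [iA|/(topN A F' HF' AF')/negPf ->] := boolP (i \in A); last first.
    by case: (j \in A); case: (k \in A); rewrite /= ?mulr1n ?mulr0n; lra.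
  have : ~~ [&& j \in A, k \notin A & rho \notin A].
    by apply/negP => /and3P[jA kA rA]; apply: F'N; exists A.
  by case: (j \in A); case: (k \in A); case: (rho \in A) => //= _;
    rewrite ?mulr1n ?mulr0n; lra.
apply/negP; rewrite -ltNge quartet_split.
have [A0 [A0F iA0 jA0 kA0 rA0]] := FA.
rewrite (bigD1 A0) //= iA0 jA0 (negPf kA0) (negPf rA0) /= ?mulr1n ?mulr0n.
apply: ltr_wpDr; last by lra.
(* a negative term would come from a cluster separating i and k from j and rho,
   against laminarity *)
rewrite sumr_ge0 // => A /andP[AF _].
have [iA|/(topN A F HF AF)/negPf ->] := boolP (i \in A); last first.
  by case: (j \in A); case: (k \in A); rewrite /= ?mulr1n ?mulr0n; lra.
have : ~~ [&& k \in A & j \notin A].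
  apply/negP => /andP[kA jA].
  case/orP: (hierarchy_laminar HF A0F AF iA0 iA) => /subsetP => [/(_ _ jA0)|/(_ _ kA)].
    by rewrite (negPf jA).
  by rewrite (negPf kA0).
by case: (j \in A); case: (k \in A); case: (rho \in A) => //= _;
  rewrite ?mulr1n ?mulr0n; lra.
Qed.

End ConeComparison.

(** * Counting parent maps by words *)

Section ParentMapCount.
Variables (V : finType) (r : V).
Implicit Types (S : {set V}) (c : V -> nat) (p q : {ffun V -> V}).

(** The trees on [S] rooted at [r] in which each [u] has [c u] children; the values
    outside [S] are frozen at [r]. *)
Definition parent_maps S c : {set {ffun V -> V}} :=
  [set p : {ffun V -> V} | [&& rooted r p, [forall v, (v \notin S) ==> (p v == r)] &
    [forall u, #|[set v in S :\ r | p v == u]| == c u]]].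

Definition root_words k c : {set k.-tuple V} :=
  [set w : k.-tuple V | (last r w == r) && [forall v, count_mem v w == c v]].

Lemma parent_mapsP S c p : reflect
  [/\ rooted r p, forall v, v \notin S -> p v = r &
      forall u, #|[set v in S :\ r | p v == u]| = c u] (p \in parent_maps S c).
Proof.
rewrite inE; apply: (iffP and3P) => [[pr /forallP pS /forallP pc]|[pr pS pc]].
  by split=> // [v vS|u]; [apply/eqP/(implyP (pS v)) | apply/eqP].
split=> //; apply/forallP => v; last exact/eqP.
by apply/implyP => /pS ->.
Qed.

Lemma root_wordsP k c (w : k.-tuple V) : reflect
  (last r w = r /\ forall v, count_mem v w = c v) (w \in root_words k c).
Proof.
rewrite inE; apply: (iffP andP) => [[/eqP wr /forallP wc]|[wr wc]].
  by split=> // v; exact/eqP.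
by split; [apply/eqP|apply/forallP => v; apply/eqP].
Qed.

Lemma parent_maps_sum S c p : p \in parent_maps S c -> \sum_u c u = #|S :\ r|.
Proof.
case/parent_mapsP => _ _ pc; rewrite -sum1_card [RHS](partition_big p xpredT) //=.
apply: eq_bigr => u _; rewrite -pc -sum1_card.
by apply: eq_bigl => v; rewrite inE.
Qed.

Lemma sum_count_mem (s : seq V) : \sum_v count_mem v s = size s.
Proof.
elim: s => [|x s IHs] /=; first by rewrite big1.
rewrite big_split /= IHs (bigD1 x) //= eqxx big1 ?addn0 // => v.
by rewrite eq_sym => /negPf ->.
Qed.

Lemma parent_maps_stable S c p v w : r \in S -> (forall v, v \notin S -> c v = 0) ->
  p \in parent_maps S c -> v \in S -> fconnect p v w -> w \in S.
Proof.
move=> rS c0 /parent_mapsP[pr _ pc] + vw; rewrite -(iter_findex vw).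
move: (findex p v w) => k; elim: k v {vw} => // k IHk v vS; rewrite iterSr.
apply: IHk; have [->|v_r] := eqVneq v r; first by rewrite (parent_root pr).
apply: contraT => /c0; rewrite -pc => /eqP; rewrite cards_eq0 => /eqP/setP/(_ v).
by rewrite !inE v_r vS eqxx.
Qed.

Lemma parent_maps_root S c p v : r \in S -> (forall v, v \notin S -> c v = 0) ->
  p \in parent_maps S c -> v \in S :\ r -> 0 < c r.
Proof.
move=> rS c0 pS; rewrite in_setD1 => /andP[v_r vS].
have /parent_mapsP[pr _ <-] := pS.
have [x xr vx] := child_toward (ancestor_root pr v) v_r.
apply/card_gt0P; exists x; rewrite inE in_setD1 (parent_maps_stable rS c0 pS vS vx) andbT.
by move: xr; rewrite inE.
Qed.

Definition upd p v u : {ffun V -> V} := [ffun x => if x == v then u else p x].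

Lemma upd_rooted p v u : rooted r p -> v != r -> u != v ->
  (forall x, x != v -> p x != v) -> rooted r (upd p v u).
Proof.
move=> pr v_r uv pv.
have reach x : x != v -> fconnect (upd p v u) x r.
  move=> xv; rewrite -(iter_findex (ancestor_root pr x)).
  move: (findex p x r) => k; elim: k x xv => [|k IHk] x xv; first exact: connect0.
  rewrite iterSr; apply: connect_trans (IHk _ (pv x xv)).
  by rewrite -[p x](_ : upd p v u x = p x) ?fconnect1 // ffunE (negPf xv).
rewrite /rooted ffunE [r == v]eq_sym (negPf v_r) (parent_root pr) eqxx.
apply/forallP => x; have [->|] := eqVneq x v; last exact: reach.
apply: connect_trans (reach u uv).
by rewrite -{2}[u](_ : upd p v u v = u) ?fconnect1 // ffunE eqxx.
Qed.

Lemma card_upd S p v u w : v \in S :\ r ->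
  #|[set x in S :\ r | upd p v u x == w]| =
  (u == w) + #|[set x in S :\ v :\ r | p x == w]|.
Proof.
move=> vS; rewrite (cardsD1 v) inE vS ffunE eqxx; congr (_ + _).
apply: eq_card => x; rewrite !inE ffunE.
by case: (eqVneq x v) => [->|_]; rewrite ?eqxx /= ?andbF.
Qed.

(** A vertex [v] without children lies on no path to the root but its own, so its
    edge to [u] can be cut off and put back. *)
Lemma card_parent_maps_remove S c v u : v \in S :\ r -> c v = 0 -> 0 < c u ->
  #|[set p in parent_maps S c | p v == u]| =
  #|parent_maps (S :\ v) (fun x => c x - (u == x))|.
Proof.
move=> vSr cv cu; have uv : u != v by apply: contraTneq cu => ->; rewrite cv.
move: (vSr); rewrite in_setD1 => /andP[v_r vS].
have updK (p : {ffun V -> V}) : p v = r -> upd (upd p v u) v r = p.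
  by move=> pv; apply/ffunP => x; rewrite !ffunE; case: eqVneq => // ->.
have no_child T d p : p \in parent_maps T d -> d v = 0 ->
    forall x, x != v -> p x != v.
  case/parent_mapsP => pr pT pd dv x xv; apply/negP => /eqP px.
  have xT : x \in T by apply: contraT => /pT; rewrite px => e; rewrite e eqxx in v_r.
  have x_r : x != r by apply: contraNneq v_r => x_r; rewrite -px x_r (parent_root pr).
  have := pd v; rewrite dv => /eqP; rewrite cards_eq0 => /eqP/setP/(_ x).
  by rewrite !inE xT x_r px eqxx.
rewrite -[RHS](card_in_imset (f := fun q => upd q v u)); last first.
  move=> p q /parent_mapsP[_ pS _] /parent_mapsP[_ qS _] pq.
  have out : v \notin S :\ v by rewrite !inE eqxx.
  by rewrite -(updK p (pS v out)) pq (updK q (qS v out)).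
apply: eq_card => p; rewrite [in LHS]inE; apply/andP/imsetP => [[pS /eqP pv]|[q qS ->]].
  have pE : upd (upd p v r) v u = p.
    by apply/ffunP => x; rewrite !ffunE; case: eqVneq => // ->.
  exists (upd p v r) => //; have /parent_mapsP[pr pout pc] := pS.
  apply/parent_mapsP; split.
  - by apply: upd_rooted => //; [rewrite eq_sym|exact: no_child pS cv].
  - move=> x; rewrite in_setD1 negb_and negbK ffunE.
    by case: eqVneq => //= _; exact: pout.
  - by move=> w; have := card_upd (upd p v r) u w vSr; rewrite pE pc => ->; rewrite addKn.
have /parent_mapsP[qr qout qc] := qS; split; last by rewrite ffunE eqxx.
apply/parent_mapsP; split.
- by apply: upd_rooted => //; apply: no_child qS _; rewrite cv.
- move=> x xS; rewrite ffunE; case: eqVneq => [xv|xv]; first by rewrite -xv (negPf xS) in vS.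
  by apply: qout; rewrite in_setD1 negb_and xS orbT.
- move=> w; rewrite card_upd // qc; have [<-|_] := eqVneq u w; last by rewrite subn0.
  by rewrite addnC subnK.
Qed.

Lemma card_root_words_remove k c u : 0 < c u -> (k = 0 -> u = r) ->
  #|[set w in root_words k.+1 c | thead w == u]| =
  #|root_words k (fun x => c x - (u == x))|.
Proof.
move=> cu ur; rewrite -[RHS](card_imset (f := cons_tuple u)); last first.
  by move=> w w' /(congr1 val) [] /val_inj.
have last_cons (w : k.-tuple V) : last r (u :: w) = last r w.
  by case: k ur w => [/(_ erefl) -> w|k _ w]; [rewrite tuple0 | case/tupleP: w].
apply: eq_card => w; rewrite [in LHS]inE; apply/andP/imsetP.
  case=> /root_wordsP[]; case/tupleP: w => x w wr wc; rewrite theadE => /eqP xu.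
  subst x; exists w; last exact: val_inj.
  apply/root_wordsP; split; first by rewrite -last_cons.
  by move=> v; rewrite -wc /= addKn.
case=> w' /root_wordsP[wr wc] ->; rewrite theadE eqxx; split=> //.
apply/root_wordsP; split; first by rewrite last_cons.
move=> v; rewrite /= wc; have [<-|_] := eqVneq u v; last by rewrite subn0.
by rewrite addnC subnK.
Qed.

(** Both sides obey the recursion that removes a leaf [v] attached to [u], respectively
    the first letter [u] of a word: this is the step of Pruefer's encoding. *)
Lemma card_parent_maps k S c : r \in S -> #|S| = k.+1 -> (forall v, v \notin S -> c v = 0) ->
  #|parent_maps S c| = #|root_words k c|.
Proof.
elim: k S c => [|k IHk] S c rS cardS c0.
  have S_r : S :\ r = set0.
    by apply/eqP; rewrite -cards_eq0; move: cardS; rewrite (cardsD1 r) rS add1n => -[->].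
  have [/forallP cz|/forallPn[v cv]] := boolP [forall v, c v == 0]; last first.
    rewrite !eq_card0 // => p; apply/negP.
      case/root_wordsP => _ /(_ v); rewrite tuple0 /= => e.
      by rewrite -e eqxx in cv.
    case/parent_mapsP => _ _ /(_ v); rewrite S_r => e.
    by case/negP: cv; rewrite -e cards_eq0; apply/eqP/setP => x; rewrite !inE.
  rewrite (_ : root_words 0 c = [set [tuple]]) ?cards1; last first.
    apply/setP => w; rewrite !inE tuple0 /= eqxx; apply/forallP => v.
    by rewrite eq_sym.
  rewrite (_ : parent_maps S c = [set [ffun=> r]]) ?cards1 //.
  have out v : v \notin S :\ r by rewrite S_r inE.
  apply/setP => p; apply/parent_mapsP/set1P => [[pr pS pc]|->].
    apply/ffunP => v; rewrite ffunE; have [->|v_r] := eqVneq v r.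
      exact: (parent_root pr).
    by apply: pS; have := out v; rewrite in_setD1 v_r.
  split=> [|v _|u]; last 2 first.
  - by rewrite ffunE.
  - rewrite S_r (eqP (cz u)); apply/eqP; rewrite cards_eq0.
    by apply/eqP/setP => x; rewrite !inE.
  rewrite /rooted ffunE eqxx; apply/forallP => v.
  by have := fconnect1 [ffun=> r] v; rewrite ffunE.
have cardSr : #|S :\ r| = k.+1 by move: cardS; rewrite (cardsD1 r) rS add1n => -[].
have [v /andP[vSr cv]|noleaf] := pickP [pred v | (v \in S :\ r) && (c v == 0)].
  have {cv} cv : c v = 0 by apply/eqP.
  rewrite -[LHS]sum1_card [LHS](partition_big (fun p : {ffun V -> V} => p v) xpredT) //=.
  rewrite -[RHS]sum1_card [RHS](partition_big (fun w : k.+1.-tuple V => thead w) xpredT) //=.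
  apply: eq_bigr => u _; rewrite !sum1dep_card.
  have [cu0|cu_gt0] := posnP (c u).
    rewrite !eq_card0 // => p; apply/negP; rewrite inE => /andP[].
      case/root_wordsP=> _ /(_ u); case/tupleP: p => x w.
      by rewrite theadE /= => + /eqP xu; rewrite xu eqxx cu0.
    case/parent_mapsP => _ _ /(_ u); rewrite cu0 => /eqP.
    by rewrite cards_eq0 => /eqP/setP/(_ v); rewrite inE vSr in_set0 /= => ->.
  have uS : u \in S by apply: contraLR cu_gt0 => /c0 ->.
  have uv : u != v by apply: contraTneq cu_gt0 => ->; rewrite cv.
  have cardSv : #|S :\ v| = k.+1.
    by move: vSr; rewrite in_setD1 => /andP[_ vS]; move: cardS; rewrite (cardsD1 v) vS => -[].
  have rSv : r \in S :\ v.
    by rewrite in_setD1 rS andbT; move: vSr; rewrite in_setD1 eq_sym => /andP[].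
  rewrite card_parent_maps_remove // card_root_words_remove //; last first.
    move=> k0; have : u \in S :\ v by rewrite in_setD1 uv.
    move: cardSv rSv; rewrite k0 => /eqP/cards1P[x ->].
    by rewrite !inE => /eqP -> /eqP ->.
  apply: IHk => // x; rewrite in_setD1 negb_and negbK => /orP[/eqP ->|/c0 -> //].
  by rewrite cv.
(* Otherwise every non-root vertex of [S] has to have a child.  If the root has one
   too, this makes at least [k + 2] children for [k + 1] edges or letters; and if it
   has none, it is not reached, respectively not a last letter. *)
have many : 0 < c r -> \sum_u c u != k.+1.
  move=> cr; rewrite gtn_eqF // -cardS -sum1_card big_mkcond /=.
  apply: leq_sum => u _; case: ifP => // uS.
  have [->//|u_r] := eqVneq u r; rewrite lt0n.
  by have /negbT := noleaf u; rewrite /= in_setD1 u_r uS.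
rewrite !eq_card0 // => p; apply/negP => pin.
  have /root_wordsP[w_last wc] := pin.
  suff cr : 0 < c r.
    by have := many cr; rewrite -(eq_bigr _ (fun v _ => wc v)) sum_count_mem size_tuple eqxx.
  rewrite -wc -has_count has_pred1 -w_last.
  by case/tupleP: {w_last wc pin} p => x w; rewrite /= mem_last.
have [v vSr] : exists v, v \in S :\ r by apply/card_gt0P; rewrite cardSr.
have := many (parent_maps_root rS c0 pin vSr).
by rewrite (parent_maps_sum pin) cardSr eqxx.
Qed.

End ParentMapCount.

(** * Trees with labelled vertices *)

Section LabelledTrees.
Variables (n : nat) (rho : 'I_n) (k : 'I_n -> nat) (m : nat).
Local Notation V := 'I_m.+1.
Local Notation labelling := ({ffun 'I_n -> V} * {ffun V -> V})%type.

Definition psi_valence (W : finType) (lam : 'I_n -> W) (v : W) : nat :=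
  \sum_(i in leaf_set lam v) k i + 3.

Definition psi_trees : {set labelling} :=
  [set x : labelling | rooted (x.1 rho) x.2 &&
    [forall v, rooted_valence x.1 (x.1 rho) x.2 v == psi_valence x.1 v]].

Definition psi_families : {set {set {set 'I_n}}} :=
  [set cluster_family x.1 x.2 | x : labelling in psi_trees].

Lemma psi_treesP (x : labelling) : reflect
  (rooted (x.1 rho) x.2 /\
    forall v, rooted_valence x.1 (x.1 rho) x.2 v = psi_valence x.1 v)
  (x \in psi_trees).
Proof.
rewrite inE; apply: (iffP andP) => -[xr xv]; split => //.
  by move=> v; apply/eqP/(forallP xv).
by apply/forallP => v; apply/eqP.
Qed.

Lemma psi_trees_trivalent (x : labelling) : x \in psi_trees ->
  forall v, 3 <= rooted_valence x.1 (x.1 rho) x.2 v.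
Proof. by case/psi_treesP => _ xv v; rewrite xv leq_addl. Qed.

Lemma psi_trees_rooted (x : labelling) : x \in psi_trees -> rooted (x.1 rho) x.2.
Proof. by case/psi_treesP. Qed.

Lemma relabel_psi_tree (W : finType) (lam : 'I_n -> W) (p : W -> W)
    (phi : W -> V) (psi : V -> W) :
  cancel phi psi -> cancel psi phi -> rooted (lam rho) p ->
  (forall v, rooted_valence lam (lam rho) p v = psi_valence lam v) ->
  ([ffun i => phi (lam i)], [ffun v => phi (p (psi v))]) \in psi_trees.
Proof.
move=> phiK psiK pr pv; apply/psi_treesP => /=.
have -> : ([ffun v => phi (p (psi v))] : V -> V) = phi \o p \o psi.
  by apply: funext => v; rewrite ffunE.
have -> : ([ffun i => phi (lam i)] : 'I_n -> V) = phi \o lam.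
  by apply: funext => v; rewrite ffunE.
split; first exact: relabel_rooted.
move=> v; rewrite -[v]psiK (relabel_valence _ _ phiK psiK) pv.
by rewrite /psi_valence (relabel_leaf_set _ phiK).
Qed.

(** Vertices are told apart by their clusters, so a family of clusters can be labelled
    in as many ways as there are bijections from labels to clusters. *)
Lemma card_family_labellings (x0 : labelling) : x0 \in psi_trees ->
  #|[set x in psi_trees | cluster_family x.1 x.2 == cluster_family x0.1 x0.2]| = m.+1`!.
Proof.
move=> x0X; have x0r := psi_trees_rooted x0X; have x0t := psi_trees_trivalent x0X.
set F := cluster_family x0.1 x0.2.
have cardF : #|F| = m.+1 by rewrite (card_cluster_family x0r x0t) card_ord.
transitivity #|[set f : {ffun V -> {set 'I_n}} in ffun_on [in F] | injectiveb f]|; last first.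
  by rewrite card_inj_ffuns_on cardF card_ord ffactnn.
pose clus (x : labelling) : {ffun V -> {set 'I_n}} := [ffun v => cluster x.1 x.2 v].
rewrite -[LHS](card_in_imset (f := clus)); last first.
  move=> x y /setIdP[xX _] /setIdP[yX _] /ffunP xy.
  have [||||v|xy1 xy2] := @cluster_determines n _ x.1 y.1 rho x.2 y.2.
  - exact: psi_trees_rooted.
  - exact: psi_trees_trivalent.
  - exact: psi_trees_rooted.
  - exact: psi_trees_trivalent.
  - by have := xy v; rewrite !ffunE.
  by move: x y {xX yX xy} xy1 xy2 => [x1 x2] [y1 y2] /= /ffunP -> /ffunP ->.
apply: eq_card => C; rewrite [RHS]inE; apply/imsetP/andP => [[x]|[CF /injectiveP Cinj]].
  case/setIdP => xX /eqP xF ->; split.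
    by apply/ffun_onP => v; rewrite ffunE -xF imset_f.
  apply/injectiveP => v w; rewrite !ffunE.
  exact: (cluster_inj (psi_trees_rooted xX) (psi_trees_trivalent xX)).
pose psi v := odflt v [pick w | cluster x0.1 x0.2 w == C v].
have psiE v : cluster x0.1 x0.2 (psi v) = C v.
  have /ffun_onP/(_ v)/imsetP[w _ Cw] := CF.
  by rewrite /psi; case: pickP => [u /eqP //|/(_ w)]; rewrite Cw eqxx.
have psi_inj : injective psi by move=> v w e; apply: Cinj; rewrite -!psiE e.
pose phi := invF psi_inj.
have phiK : cancel phi psi by exact: f_invF.
have psiK : cancel psi phi by exact: invF_f.
have /psi_treesP[_ x0v] := x0X.
have xX := relabel_psi_tree phiK psiK x0r x0v.
have lamE : ([ffun i => phi (x0.1 i)] : 'I_n -> V) = phi \o x0.1.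
  by apply: funext => i; rewrite ffunE.
have pE : ([ffun v => phi (x0.2 (psi v))] : V -> V) = phi \o x0.2 \o psi.
  by apply: funext => v; rewrite ffunE.
exists ([ffun i => phi (x0.1 i)], [ffun v => phi (x0.2 (psi v))]).
  apply/setIdP; split => //=; rewrite lamE pE.
  by rewrite (relabel_cluster_family _ _ phiK psiK).
apply/ffunP => v; rewrite ffunE /= -psiE lamE pE -{2}[v]psiK.
by rewrite (relabel_cluster _ _ phiK).
Qed.

Lemma card_psi_trees : #|psi_trees| = #|psi_families| * m.+1`!.
Proof.
rewrite -sum1_card (partition_big (fun x : labelling => cluster_family x.1 x.2)
  [in psi_families]) /=; last by move=> x xX; apply: imset_f.
rewrite -sum_nat_const; apply: eq_bigr => F /imsetP[x xX ->].
by rewrite sum1dep_card card_family_labellings.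
Qed.

(** The second component replaces the parent map: the number of children of [v] has
    become the number of occurrences of [v]. *)
Definition psi_words : {set {ffun 'I_n -> V} * m.-tuple V} :=
  [set x : {ffun 'I_n -> V} * m.-tuple V | (last (x.1 rho) x.2 == x.1 rho) && [forall v,
    count_mem v x.2 + (v != x.1 rho) + #|leaf_set x.1 v| == psi_valence x.1 v]].

(** For given positions of the leaves, the valence condition prescribes the number of
    children of each vertex. *)
Lemma card_psi_words : #|psi_trees| = #|psi_words|.
Proof.
have cardX (A B : finType) (Z : {set A * B}) :
    #|Z| = \sum_a #|[set b | (a, b) \in Z]|.
  transitivity (\sum_a \sum_b (if (a, b) \in Z then 1 else 0)).
    by rewrite pair_bigA -sum1_card big_mkcond /=; apply: eq_bigr => -[].
  apply: eq_bigr => a _; rewrite -big_mkcond /= -sum1_card.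
  by apply: eq_bigl => b; rewrite inE.
rewrite !cardX; apply: eq_bigr => lam _; set r := lam rho.
pose b v := (v != r) + #|leaf_set lam v|.
have [/forallP bP|/forallPn[v vN]] := boolP [forall v, b v <= psi_valence lam v]; last first.
  rewrite !eq_card0 // => x; apply: contraNF vN; rewrite !inE /= => /andP[_ /forallP/(_ v)].
    by rewrite -addnA -/(b v) => /eqP <-; exact: leq_addl.
  by rewrite /rooted_valence -addnA -/(b v) => /eqP <-; exact: leq_addl.
have := @card_parent_maps V r m [set: V] (fun v => psi_valence lam v - b v).
rewrite inE cardsT card_ord => /(_ isT erefl) count.
have arith x v : (x + b v == psi_valence lam v) = (x == psi_valence lam v - b v).
  by rewrite -[in RHS](eqn_add2r (b v)) subnK.
rewrite (_ : [set p | _] = parent_maps r setT (fun v => psi_valence lam v - b v)).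
  rewrite count; last by move=> v; rewrite inE.
  apply: eq_card => w; rewrite !inE /= -/r; congr (_ && _).
  by apply: eq_forallb => v; rewrite -addnA arith.
apply/setP => p; rewrite !inE /= -/r; case: (boolP (rooted r p)) => //= pr.
rewrite (_ : [forall v, _ ==> _] = true) /=; last by apply/forallP => v; rewrite inE.
apply: eq_forallb => u; rewrite /rooted_valence -addnA arith; congr (#|pred_of_set _| == _).
apply/setP => x; rewrite !inE andbT; have [pxu|] := eqVneq (p x) u; last by rewrite !andbF.
rewrite !andbT -pxu; have [->|x_r] := eqVneq x r; first by rewrite (parent_root pr) eqxx.
by rewrite eq_sym (parent_neq pr).
Qed.

End LabelledTrees.

(** * Moduli sequences *)

Section Codes.
Variables (n : nat) (rho : 'I_n) (k : 'I_n -> nat) (d : nat).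
Local Notation V := 'I_d.+1.
Hypotheses (hn : 3 <= n) (rho0 : rho = 0 :> nat).
Hypothesis hlast : d = 0 -> forall i : 'I_n, i.+1 = n -> k i = 0.
Implicit Types (P : (n + d).-1.-tuple V).

Definition psi_codes : {set (n + d).-1.-tuple V} :=
  [set P : (n + d).-1.-tuple V | [forall v, count_mem v P ==
    2 + \sum_(j < (n + d).-1 | tnth P j == v) extend0 k j]].

(** A sequence followed by a copy of its first letter: the first [n] letters are then
    the vertices of the leaves, and the others a word for the parent map, whose last
    letter has to be the root, that is the vertex of the first leaf. *)
Definition closed_code P (j : nat) : V := nth ord0 (rcons P (head ord0 P)) j.

Definition code_word P : {ffun 'I_n -> V} * d.-tuple V :=
  ([ffun i : 'I_n => closed_code P i], [tuple closed_code P (n + j) | j < d]).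

Let nd : (n + d).-1.+1 = n + d.
Proof. by rewrite prednK // addn_gt0 (leq_trans _ hn). Qed.

Lemma closed_code_lt P (j : 'I_(n + d).-1) : closed_code P j = tnth P j.
Proof. by rewrite /closed_code nth_rcons size_tuple ltn_ord (tnth_nth ord0). Qed.

Lemma closed_code_last P : closed_code P (n + d).-1 = head ord0 P.
Proof. by rewrite /closed_code nth_rcons size_tuple ltnn eqxx. Qed.

Lemma closed_code0 P : closed_code P 0 = head ord0 P.
Proof.
rewrite /closed_code nth_rcons size_tuple -nth0.
by rewrite -ltnS nd (leq_trans _ (leq_addr _ _)) // (leq_trans _ hn).
Qed.

Lemma code_word_inj : injective code_word.
Proof.
move=> P P' PP'; have /ffunP lamE := congr1 fst PP'; apply: eq_from_tnth => j.
rewrite -!closed_code_lt; have [jn|nj] := ltnP j n.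
  by have := lamE (Ordinal jn); rewrite !ffunE.
have jd : j - n < d.
  by rewrite -(ltn_add2l n) subnKC // (leq_trans (ltn_ord j)) ?leq_pred.
have := congr1 (fun x => tnth x.2 (Ordinal jd)) PP'.
by rewrite !tnth_mktuple /= subnKC.
Qed.

Lemma extend0_ge j : n <= j -> extend0 k j = 0.
Proof. by move=> nj; rewrite /extend0 insubN // -leqNgt. Qed.

(** The repeated letter does not contribute to the exponents: for positive [d] its
    position is beyond the leaves, and for [d = 0] it is that of the last leaf. *)
Lemma extend0_last : extend0 k (n + d).-1 = 0.
Proof.
have [d0|d_gt0] := posnP d; last first.
  by apply: extend0_ge; rewrite -ltnS nd -addn1 leq_add2l.
rewrite d0 addn0 /extend0; case: insubP => // i _ ni.
by apply: (hlast d0); rewrite ni prednK // (leq_trans _ hn).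
Qed.

Lemma sum_closed_code (T : nat -> V -> nat) P :
  \sum_(j < (n + d).-1) T j (tnth P j) + T (n + d).-1 (head ord0 P) =
  \sum_(i < n) T i (closed_code P i) + \sum_(j < d) T (n + j) (closed_code P (n + j)).
Proof.
transitivity (\sum_(j < n + d) T j (closed_code P j)); last by rewrite big_split_ord.
rewrite -(big_mkord xpredT (fun j => T j (closed_code P j))) -[X in index_iota 0 X]nd.
rewrite big_nat_recr //= closed_code_last big_mkord; congr (_ + _).
by apply: eq_bigr => j _; rewrite closed_code_lt.
Qed.

Lemma count_closed_code v P :
  count_mem v P + (head ord0 P == v) =
  #|leaf_set (code_word P).1 v| + count_mem v (code_word P).2.
Proof.
have countE m (w : m.-tuple V) : count_mem v w = \sum_(j < m) (tnth w j == v).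
  by rewrite -sum1_count big_tuple big_mkcond.
rewrite !countE (sum_closed_code (fun _ x => x == v)); congr (_ + _).
  rewrite -sum1_card [RHS]big_mkcond /=; apply: eq_bigr => i _.
  by rewrite !inE ffunE; case: eqP.
by apply: eq_bigr => j _; rewrite tnth_mktuple.
Qed.

Lemma psi_valence_code v P :
  psi_valence k (code_word P).1 v =
  \sum_(j < (n + d).-1 | tnth P j == v) extend0 k j + 3.
Proof.
congr (_ + _).
have := sum_closed_code (fun j x => if x == v then extend0 k j else 0) P.
rewrite extend0_last if_same addn0 => sumE.
rewrite [RHS]big_mkcond /= sumE [LHS]big_mkcond /=.
rewrite [X in _ = _ + X]big1 ?addn0; last first.
  by move=> j _; rewrite extend0_ge ?leq_addr ?if_same.
by apply: eq_bigr => i _; rewrite !inE ffunE /extend0 valK.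
Qed.

Lemma mem_code_word P : (code_word P \in psi_words rho k d) = (P \in psi_codes).
Proof.
rewrite !inE; have -> : (code_word P).1 rho = head ord0 P by rewrite ffunE rho0 closed_code0.
have -> /= : last (head ord0 P) (code_word P).2 == head ord0 P.
  rewrite (last_nth ord0) size_tuple; have [d0|d_gt0] := posnP d.
    by rewrite [X in nth _ _ X]d0.
  have d1 : d.-1 < d by rewrite prednK.
  rewrite -[X in nth _ _ X](prednK d_gt0) /= (nth_mktuple _ _ (Ordinal d1)) /=.
  have -> : n + d.-1 = (n + d).-1 by rewrite -[in RHS](prednK d_gt0) addnS.
  by rewrite closed_code_last.
apply: eq_forallb => v; rewrite psi_valence_code addnAC [_ + #|_|]addnC -count_closed_code.
have e : (head ord0 P == v) + (v != head ord0 P) = 1 by rewrite eq_sym; case: eqP.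
rewrite -addnA e.
by rewrite addn1 addn3 !eqSS add2n.
Qed.

Lemma code_word_onto x : x \in psi_words rho k d -> exists P, code_word P = x.
Proof.
rewrite inE; case: x => lam w /= /andP[/eqP w_last _].
pose g j : V := if insub j is Some i then lam i else nth ord0 w (j - n).
have g_lam (i : 'I_n) : g i = lam i by rewrite /g valK.
have g_w j : g (n + j) = nth ord0 w j.
  by rewrite /g insubN ?addKn // -leqNgt leq_addr.
pose P := [tuple g j | j < (n + d).-1]; exists P.
have P0 : head ord0 P = lam rho.
  have lt0 : 0 < (n + d).-1.
    by rewrite -ltnS nd (leq_trans _ (leq_addr _ _)) // (leq_trans _ hn).
  by rewrite -nth0 (nth_mktuple _ _ (Ordinal lt0)) -g_lam rho0.
have gP j : j < n + d -> closed_code P j = g j.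
  rewrite -nd ltnS leq_eqVlt => /orP[/eqP ->|jlt]; last first.
    by rewrite (closed_code_lt P (Ordinal jlt)) tnth_mktuple.
  rewrite closed_code_last P0; have [d0|d_gt0] := posnP d.
    by apply: ord_inj; move: (lam rho) (g _); rewrite d0 => x y; rewrite !ord1.
  have -> : (n + d).-1 = n + d.-1 by rewrite -[in LHS](prednK d_gt0) addnS.
  by rewrite g_w -w_last (last_nth ord0) size_tuple -[X in nth _ _ X](prednK d_gt0).
congr (_, _).
  by apply/ffunP => i; rewrite ffunE gP ?g_lam // (leq_trans (ltn_ord i)) ?leq_addr.
apply: eq_from_tnth => j; rewrite tnth_mktuple gP ?ltn_add2l // g_w.
by rewrite (tnth_nth ord0).
Qed.

Lemma card_psi_codes : #|psi_codes| = #|psi_words rho k d|.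
Proof.
rewrite -(card_imset _ code_word_inj); apply: eq_card => x; apply/imsetP/idP.
  by case=> P; rewrite -mem_code_word => ? ->.
move=> xW; have [P Px] := code_word_onto xW.
by exists P; rewrite // -mem_code_word Px.
Qed.

Definition first_letters (s : seq V) : seq V := rev (undup (rev s)).

Definition ordered_codes : {set (n + d).-1.-tuple V} :=
  [set P in psi_codes | first_letters P == enum V].

Lemma first_letters_map (f : V -> V) s : injective f ->
  first_letters (map f s) = map f (first_letters s).
Proof. by move=> f_inj; rewrite /first_letters -map_rev undup_map_inj // map_rev. Qed.

Lemma psi_codes_map (f : V -> V) (f_inj : injective f) P :
  P \in psi_codes -> [tuple of map f P] \in psi_codes.
Proof.
rewrite !inE => /forallP Pk; apply/forallP => v.
rewrite -[v](f_invF f_inj); set u := invF _ _.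
rewrite count_map (eq_count (a2 := pred1 u)) => [|x]; last by rewrite /= (inj_eq f_inj).
rewrite (eqP (Pk u)); apply/eqP; congr (2 + _); apply: eq_bigl => j.
by rewrite tnth_map (inj_eq f_inj).
Qed.

(** In a code every letter occurs, so that exactly one relabelling is ordered. *)
Lemma card_ordered_codes : #|psi_codes| = #|ordered_codes| * d.+1`!.
Proof.
pose injs := [set f : {ffun V -> V} | injectiveb f].
have inj_injs f : f \in injs -> injective f by rewrite inE => /injectiveP.
have -> : d.+1`! = #|injs| by rewrite card_inj_ffuns card_ord ffactnn.
rewrite -cardsX.
pose F (x : (n + d).-1.-tuple V * {ffun V -> V}) := [tuple of map x.2 x.1].
rewrite -(card_in_imset (f := F)); last first.
  move=> [P f] [Q g] /setXP[/setIdP[_ /eqP Pf] /inj_injs fi].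
  move=> /setXP[/setIdP[_ /eqP Qg] /inj_injs gi] /(congr1 val) /= FPQ.
  have := congr1 first_letters FPQ.
  rewrite !first_letters_map //= Pf Qg => /eq_in_map fg.
  have {}fg : f = g by apply/ffunP => v; apply: fg; rewrite mem_enum.
  by move: FPQ; rewrite fg => /(inj_map gi) /val_inj ->.
apply: eq_card => P; apply/idP/imsetP => [Pk|[[Q f] /setXP[/setIdP[Qk _] fi] ->]].
  have mem_P v : v \in first_letters P.
    rewrite /first_letters mem_rev mem_undup mem_rev -has_pred1 has_count.
    by move: Pk; rewrite inE => /forallP/(_ v)/eqP ->.
  have uniqP : uniq (first_letters P) by rewrite rev_uniq undup_uniq.
  have sizeP : size (first_letters P) = d.+1.
    rewrite -(card_uniqP uniqP) -[RHS](card_ord d.+1); apply: eq_card => v.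
    by rewrite mem_P.
  pose f : {ffun V -> V} := [ffun v : V => nth ord0 (first_letters P) v].
  have fi : injective f.
    move=> u v; rewrite !ffunE => /eqP; rewrite nth_uniq ?sizeP //.
    by move=> /eqP /ord_inj.
  have fP : first_letters P = map f (enum V).
    apply: (@eq_from_nth _ ord0); first by rewrite size_map size_enum_ord.
    move=> i; rewrite sizeP => i_lt.
    by rewrite (nth_map ord0) ?size_enum_ord // ffunE nth_enum_ord.
  have gi : injective (invF fi) by exact: can_inj (f_invF fi).
  exists ([tuple of map (invF fi) P], f); last first.
    apply: val_inj; rewrite /= -map_comp -[LHS]map_id; apply: eq_map => x /=.
    by rewrite f_invF.
  apply/setXP; split; last by rewrite inE; apply/injectiveP.
  apply/setIdP; split; first exact: psi_codes_map.
  rewrite first_letters_map // fP -map_comp -[X in _ == X]map_id; apply/eqP.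
  by apply: eq_map => x /=; rewrite invF_f.
by apply: psi_codes_map => //; apply: inj_injs.
Qed.

End Codes.

(** * Cones and moduli sequences *)

(** Only the existence of a bijection is at stake, so equal finite cardinals suffice. *)
Lemma set_bij_images (A B : finType) (T U : Type) (X : {set A}) (Y : {set B})
    (g : A -> T) (h : B -> U) (u0 : U) :
  {in X &, injective g} -> {in Y &, injective h} -> #|X| = #|Y| ->
  exists f : T -> U,
    set_bij [set g a | a in [set` X]]%classic [set h b | b in [set` Y]]%classic f.
Proof.
move=> g_inj h_inj XY.
(* the elements of [X] and [Y] are paired in the order of their enumerations *)
pose G a := nth None [seq Some b | b <- enum Y] (index a (enum X)).
pose F a := oapp h u0 (G a).
have idx a : a \in X -> index a (enum X) < size [seq Some b | b <- enum Y].
  by move=> aX; rewrite size_map -cardE -XY cardE index_mem mem_enum.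
have GE a : a \in X -> exists2 b, b \in Y & G a = Some b.
  by move=> /idx/(mem_nth None)/mapP[b]; rewrite mem_enum; exists b.
have /choice[f fP] t : exists u, forall a, a \in X -> g a = t -> u = F a.
  have [[a aX <-]|none] := pselect (exists2 a, a \in X & g a = t).
    by exists (F a) => a' a'X /g_inj -> //.
  by exists u0 => a aX gat; case: none; exists a.
have fg a : a \in X -> f (g a) = F a by move=> aX; exact: (fP _ a).
exists f; split.
- move=> _ [a /= aX <-]; rewrite fg // /F.
  by have [b bY ->] := GE a aX; exists b.
- move=> t t' /set_mem[a /= aX <-] /set_mem[a' /= a'X <-]; rewrite !fg // /F.
  have [b bY Gb] := GE a aX; have [b' b'Y Gb'] := GE a' a'X.
  rewrite Gb Gb' /= => /h_inj bb'; have : G a = G a' by rewrite Gb Gb' bb'.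
  move=> /eqP; rewrite /G nth_uniq ?idx ?(map_inj_uniq Some_inj) ?enum_uniq //.
  move=> /eqP e; congr g.
  by rewrite -[a](nth_index a (s := enum X)) ?e ?nth_index ?mem_enum.
- move=> _ [b /= bY <-].
  have lt : index b (enum Y) < size (enum X).
    by rewrite -cardE XY cardE index_mem mem_enum.
  have [a0 _] : exists a0, a0 \in X by apply/card_gt0P; rewrite cardE (leq_ltn_trans _ lt).
  pose a := nth a0 (enum X) (index b (enum Y)).
  have aX : a \in X by rewrite -mem_enum mem_nth.
  exists (g a); first by exists a.
  rewrite fg // /F /G index_uniq ?enum_uniq // (nth_map b) ?index_mem ?mem_enum //.
  by rewrite nth_index ?mem_enum.
Qed.

Section PsiCones.
Variables (R : realType) (n : nat) (rho : 'I_n) (k : 'I_n -> nat) (d : nat).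
Hypothesis hn : 3 <= n.
Hypothesis hd : d = n - 3 - \sum_(i < n) k i.
Local Notation fams := (psi_families rho k d).
Local Notation V := 'I_d.+1.

Lemma psi_families_hierarchy F : F \in fams -> hierarchy rho F /\ #|F| = d.+1.
Proof.
case/imsetP => x xX ->.
have xr := psi_trees_rooted xX; have xt := psi_trees_trivalent xX; split.
  exact: cluster_family_hierarchy.
by rewrite (card_cluster_family xr xt) card_ord.
Qed.

(** The number of edges fixes the number of vertices, [d + 1], so every curve type in
    question has a copy with vertex set ['I_d.+1]. *)
Lemma psi_top_conesE :
  psi_top_cones (R := R) k = [set family_cone F | F in [set` fams]]%classic.
Proof.
apply/seteqP; split => [_ [T [[T_tree Tval] Tedges Tpsi ->]]|_ [_ /imsetP[x xX ->] <-]].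
  have [p [pr adjE]] := tree_parent_map (leaf_vertex T rho) T_tree.
  have pv v : rooted_valence (leaf_vertex T) (leaf_vertex T rho) p v =
              psi_valence k (leaf_vertex T) v.
    by rewrite -(parent_valence pr adjE) Tpsi.
  have pt v : 3 <= rooted_valence (leaf_vertex T) (leaf_vertex T rho) p v.
    by rewrite pv leq_addl.
  have cardV : #|vertex T| = d.+1.
    by rewrite -(card_bounded_edges pr adjE) Tedges hd.
  pose phi v : V := cast_ord cardV (enum_rank v).
  pose psi (i : V) : vertex T := enum_val (cast_ord (esym cardV) i).
  have phiK : cancel phi psi by move=> v; rewrite /psi /phi cast_ordK enum_rankK.
  have psiK : cancel psi phi by move=> i; rewrite /psi /phi enum_valK cast_ordKV.
  exists (cluster_family (leaf_vertex T) p); last by rewrite (coneE R pr adjE pt).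
  rewrite -(relabel_cluster_family _ _ phiK psiK) /=; apply/imsetP.
  exists ([ffun i => phi (leaf_vertex T i)], [ffun v => phi (p (psi v))]).
    exact: relabel_psi_tree.
  by congr cluster_family; apply: funext => v; rewrite ffunE.
have [xr xv] := psi_treesP _ _ _ xX; have xt := psi_trees_trivalent xX.
pose T := MarkedGraph
  (fun v w : V => (v != w) && ((x.2 v == w) || (x.2 w == v))) x.1.
have adjE (v w : vertex T) : adj v w = (v != w) && ((x.2 v == w) || (x.2 w == v)) by [].
exists T; split.
- split; first exact: (@parent_is_tree n T _ _ xr adjE).
  by move=> v; rewrite (@parent_valence n T _ _ xr adjE).
- by apply: succn_inj; rewrite (@card_bounded_edges n T _ _ xr adjE) card_ord hd.
- by move=> v; rewrite (@parent_valence n T _ _ xr adjE) xv.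
- by rewrite (@coneE R n T rho _ xr adjE xt).
Qed.

Lemma family_cone_eq F F' : F \in fams -> F' \in fams ->
  (family_cone (R := R) F `<=` family_cone F')%classic -> F = F'.
Proof.
move=> /psi_families_hierarchy[HF cF] /psi_families_hierarchy[HF' cF'] sub.
by apply/eqP; rewrite eqEcard (family_cone_subset HF HF' sub) cF cF' leqnn.
Qed.

(** All the top cones have the same number of clusters, so none contains another. *)
Lemma maximal_psi_cones : maximal_cones (psi_product (R := R) k) =
  [set family_cone F | F in [set` fams]]%classic.
Proof.
have top s : psi_top_cones (R := R) k s -> psi_product k s.
  by move=> ks; split; [case: ks => T [? _ _ ?]; exists T | exists s].
apply/seteqP; split => [s [[_ [t kt st]] smax]|_ [F Ffam <-]].
  by rewrite -psi_top_conesE -(smax t (top t kt) st).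
split; first by apply: top; rewrite psi_top_conesE; exists F.
move=> t [_ [t' kt' tt']] Ft; move: kt' tt'; rewrite psi_top_conesE => -[F' F'fam <-] tF'.
have FF' : F = F'.
  by apply: (family_cone_eq Ffam F'fam); exact: classical_sets.subset_trans tF'.
by apply/seteqP; split => //; rewrite FF'.
Qed.

Lemma card_psi_families :
  rho = 0 :> nat -> (d = 0 -> forall i : 'I_n, i.+1 = n -> k i = 0) ->
  #|fams| = #|ordered_codes k d|.
Proof.
move=> rho0 hlast; apply/eqP; rewrite -(eqn_pmul2r (fact_gt0 d.+1)); apply/eqP.
by rewrite -card_psi_trees card_psi_words -card_psi_codes // card_ordered_codes.
Qed.

End PsiCones.

Section ModuliSequences.
Variables (n : nat) (k : 'I_n -> nat) (d : nat).
Local Notation V := 'I_d.+1.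

Definition letter (v : V) : nat := n + 1 + v.

Lemma letter_inj : injective letter.
Proof. by move=> v w /addnI /ord_inj. Qed.

Lemma count_letters (s : seq V) v : count_mem (letter v) (map letter s) = count_mem v s.
Proof. by rewrite count_map; apply: eq_count => x /=; rewrite (inj_eq letter_inj). Qed.

Lemma ordered_letters (s : seq V) : (forall v, v \in s) ->
  is_ordered (map letter s) <-> first_letters s = enum V.
Proof.
move=> all_s; rewrite /is_ordered.
have -> : first_occurrences (map letter s) = map letter (first_letters s).
  by rewrite /first_occurrences -map_rev undup_map_inj ?map_rev //; exact: letter_inj.
pose le (v w : V) := v <= w.
have -> : sorted leq (map letter (first_letters s)) = sorted le (first_letters s).
  by rewrite sorted_map; apply: eq_sorted => v w; rewrite /= leq_add2l.
have enum_sorted : sorted le (enum V).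
  have : sorted leq (map val (enum V)) by rewrite val_enum_ord iota_sorted.
  by rewrite sorted_map.
split=> [s_sorted|->//].
apply: (sorted_eq (leT := le)) => //.
- by move=> v u w; exact: leq_trans.
- by move=> v w; rewrite /le -eqn_leq => /eqP/ord_inj.
- apply: uniq_perm; rewrite ?enum_uniq ?rev_uniq ?undup_uniq // => v.
  by rewrite mem_enum /first_letters mem_rev mem_undup mem_rev all_s.
Qed.

Lemma moduli_codes :
  [set P : (n + d).-1.-tuple nat |
         ordered_moduli_sequences n d P /\
         forall a : nat, n + 1 <= a <= n + d + 1 ->
           count_mem a P =
             2 + \sum_(j < (n + d).-1 | tnth P j == a) extend0 k j]%classic =
  [set [tuple of map letter Q] | Q in [set` ordered_codes k d]]%classic.
Proof.
have letterP a : n + 1 <= a <= n + d + 1 -> exists v, a = letter v.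
  case/andP => na ad; have lt : a - (n + 1) < d.+1 by rewrite ltn_subLR // addnS ltnS addnAC.
  by exists (Ordinal lt); rewrite /letter /= subnKC.
have letter_range v : n + 1 <= letter v <= n + d + 1.
  by rewrite leq_addr /= /letter addnAC leq_add2r leq_add2l -ltnS.
have tnthE (Q : (n + d).-1.-tuple V) v j :
    (tnth [tuple of map letter Q] j == letter v) = (tnth Q j == v).
  by rewrite tnth_map (inj_eq letter_inj).
have all_letters (Q : (n + d).-1.-tuple V) v : 2 <= count_mem v Q -> v \in Q.
  by move=> Qv; rewrite -has_pred1 has_count (leq_trans _ Qv).
apply/seteqP; split => [P [[[Pr Pc] Pord] Pk]|_ [Q /= /setIdP[Qk /eqP Qord] <-]].
  have [Q PQ] : exists Q : (n + d).-1.-tuple V, P = [tuple of map letter Q].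
    exists [tuple of map (fun a => inord (a - (n + 1))) P].
    apply: val_inj; rewrite /= -map_comp -[LHS]map_id; apply/eq_in_map => a aP /=.
    have [v ->] := letterP a (Pr a aP).
    by rewrite /letter addKn inord_val.
  subst P; exists Q => //=; apply/setIdP; split.
    rewrite inE; apply/forallP => v; rewrite -count_letters (Pk _ (letter_range v)).
    by apply/eqP; congr (2 + _); apply: eq_bigl => j; rewrite tnthE.
  apply/eqP/ordered_letters => // v; apply: all_letters.
  by rewrite -count_letters (Pc _ (letter_range v)).
have countQ a : n + 1 <= a <= n + d + 1 ->
    count_mem a [tuple of map letter Q] =
    2 + \sum_(j < (n + d).-1 | tnth [tuple of map letter Q] j == a) extend0 k j.
  move=> /letterP[v ->]; rewrite count_letters.
  move: Qk; rewrite inE => /forallP/(_ v)/eqP ->.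
  by congr (2 + _); apply: eq_bigl => j; rewrite tnthE.
split=> //; split; first split.
- by move=> a /mapP[v _ ->].
- by move=> a ar; rewrite countQ.
- apply/ordered_letters => // v; apply: all_letters.
  by rewrite -count_letters countQ.
Qed.

End ModuliSequences.

Local Open Scope classical_set_scope.
Local Open Scope nat_scope.

Theorem corollary6p13 (R : realType) (n : nat) (k : 'I_n -> nat) (d : nat)
    (hn : 3 <= n)
    (hk : \sum_(i < n) k i <= n - 3)
    (hd : d = n - 3 - \sum_(i < n) k i)
    (hlast : d = 0 -> forall i : 'I_n, i.+1 = n -> k i = 0) :
  exists f : set (dist_quot R n) -> (n + d).-1.-tuple nat,
    set_bij (maximal_cones (psi_product (R := R) k))
      [set P : (n + d).-1.-tuple nat |
         ordered_moduli_sequences n d P /\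
         forall a : nat, n + 1 <= a <= n + d + 1 ->
           count_mem a P =
             2 + \sum_(j < (n + d).-1 | tnth P j == a) extend0 k j]
      f.
Proof.
pose rho : 'I_n := Ordinal (ltn_trans (isT : 0 < 2) hn).
rewrite moduli_codes (maximal_psi_cones R rho hd).
apply: set_bij_images; first exact: [tuple of nseq _ 0].
- move=> F F' Ffam F'fam e; apply: (family_cone_eq (R := R) Ffam F'fam).
  by rewrite e.
- move=> Q Q' _ _ /(congr1 val) /= /(inj_map (@letter_inj n d)); exact: val_inj.
- exact: card_psi_families.
Qed.
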